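(* Let $D\subset\mathbb C$ be a non-empty open set invariant under complex conjugation, with $\Omega_D$ connected, and let $f:\Omega_D\to A$ be any function. The following assertions hold. (i) If $D\cap\mathbb R=\emptyset$, then $f$ is a slice regular function if and only if $f$ is a slice function and is spherically analytic. (ii) If $D\cap\mathbb R\neq\emptyset$, then $f$ is a slice regular function if and only if $f$ is spherically analytic.
   Context: Algebra. $A$ is a finite-dimensional real alternative algebra with unity $1$ (so $\mathbb R\subset A$), equipped with a real linear anti-involution $x\mapsto x^c$ (so $(x^c)^c=x$, $(xy)^c=y^cx^c$). Put $t(x):=x+x^c$, $n(x):=xx^c$. The quadratic cone is $\mathcal Q_A:=\mathbb R\cup\{x\in A: t(x)\in\mathbb R,\ n(x)\in\mathbb R,\ 4n(x)>t(x)^2\}$; $\mathbb S_A:=\{J\in\mathcal Q_A: J^2=-1\}$ is assumed non-empty; for $J\in\mathbb S_A$, $\mathbb C_J:=\mathbb R+\mathbb RJ\simeq\mathbb C$. One has $\mathcal Q_A=\bigcup_{J}\mathbb C_J$ and $\mathbb C_I\cap\mathbb C_J=\mathbb R$ if $I\ne\pm J$. $A$ is equipped with a norm $\|\cdot\|_A$ such that $\|x\|_A=\sqrt{n(x)}$ for all $x\in\mathcal Q_A$; ''open'' in $\mathcal Q_A$ refers to the euclidean topology. Slice functions. For $D\subset\mathbb C$ non-empty, open and conjugation invariant, $\Omega_D:=\{\alpha+\beta J: \alpha,\beta\in\mathbb R,\ \alpha+i\beta\in D,\ J\in\mathbb S_A\}$; sets of this form are called circular. A stem function is a map $F=F_1+iF_2:D\to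 A\otimes_{\mathbb R}\mathbb C$ ($F_1,F_2$ $A$-valued) with $F_1(\bar z)=F_1(z)$, $F_2(\bar z)=-F_2(z)$. It induces the slice function $f=\mathcal I(F):\Omega_D\to A$, $f(\alpha+\beta J):=F_1(z)+JF_2(z)$, $z=\alpha+i\beta$. A slice function is slice regular if it is induced by a stem function $F$ of class $C^1$ which is holomorphic, i.e. $\frac{\partial F}{\partial\bar z}:=\frac12\big(\frac{\partial F}{\partial\alpha}+i\frac{\partial F}{\partial\beta}\big)=0$. Spherical series. For $y\in\mathcal Q_A$ put $\Delta_y(x):=x^2-x\,t(y)+n(y)$, and for $m\in\mathbb N$, $\mathscr S_{y,2m}(x):=\Delta_y(x)^m$, $\mathscr S_{y,2m+1}(x):=\Delta_y(x)^m(x-y)$; these are the slice functions on $\mathcal Q_A$ induced by $z\mapsto\Delta_y(z)^m$ and $z\mapsto\Delta_y(z)^m(z-y)$. For $s\in A$, $\mathscr S_{y,n}(x)s$ denotes the value at $x$ of the slice function induced by $z\mapsto \mathscr S_{y,n}(z)s$ (products in $A\otimes_{\mathbb R}\mathbb C$). Pseudo-metric. $\mathrm u_A(x,y):=\sqrt{\|\Delta_y(x)\|_A}$ for $x,y\in\mathcal Q_A$ (a pseudo-metric on $\mathcal Q_A$); the $\mathrm u_A$-ball centered at $y$ of radius $r$ is $\{x\in\mathcal Q_A:\mathrm u_A(x,y)<r\}$. Analyticity. A function $f:V\to A$ on a non-empty circular open subset $V$ of $\mathcal Q_A$ is spherically analytic ($\mathrm u_A$-analytic) if for each $y\in V$ there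 exist a non-empty $\mathrm u_A$-ball $\mathrm U$ centered at $y$ and contained in $V$, and a series $\sum_{n\in\mathbb N}\mathscr S_{y,n}(x)s_n$ with $s_n\in A$, which converges to $f(x)$ for each $x\in\mathrm U\cap V$. *)

(* Defs.v *)
From HB Require Import structures.
From mathcomp Require Import all_boot all_order all_algebra.
From mathcomp Require Import all_classical all_reals all_analysis.

Set Implicit Arguments.
Unset Strict Implicit.
Unset Printing Implicit Defensive.

Import Order.TTheory GRing.Theory Num.Theory.
Import numFieldNormedType.Exports.

Local Open Scope classical_set_scope.
Local Open Scope ring_scope.

(* MathComp's rings are associative, so the product of an alternative algebra
   is declared here.  The scalar a : R is seen in A as a *: aone. *)
HB.mixin Record isAltStarAlgebra (R : realType) A of GRing.Lmodule R A := {
  amul : A -> A -> A;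
  aone : A;
  aconj : A -> A;
  amulDl : forall x y z : A, amul (x + y) z = amul x z + amul y z;
  amulDr : forall x y z : A, amul x (y + z) = amul x y + amul x z;
  amulZl : forall (a : R) (x y : A), amul (a *: x) y = a *: amul x y;
  amulZr : forall (a : R) (x y : A), amul x (a *: y) = a *: amul x y;
  amul1x : forall x : A, amul aone x = x;
  amulx1 : forall x : A, amul x aone = x;
  aone_neq0 : aone != 0;
  amul_altl : forall x y : A, amul x (amul x y) = amul (amul x x) y;
  amul_altr : forall x y : A, amul (amul x y) y = amul x (amul y y);
  aconjD : forall x y : A, aconj (x + y) = aconj x + aconj y;
  aconjZ : forall (a : R) (x : A), aconj (a *: x) = a *: aconj x;
  aconjK : forall x : A, aconj (aconj x) = x;
  aconjM : forall x y : A, aconj (amul x y) = amul (aconj y) (aconj x)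
}.

(* Finite-dimensional real alternative *-algebras carrying a norm of real vector
   spaces; Vector provides finite dimension. *)
#[short(type="normedAltStarAlgType")]
HB.structure Definition NormedAltStarAlgebra (R : realType) :=
  { A of NormedModule R A & Vector R A & isAltStarAlgebra R A }.

Section Definitions.
Variables (R : realType) (A : normedAltStarAlgType R).

Local Notation "x ** y" := (@amul R A x y) (at level 40, left associativity).
Local Notation "1A" := (@aone R A).
(* alpha + i beta in C is the pair (alpha, beta), with the product topology. *)
Local Notation C := (R * R)%type.
(* F1 + i F2 in the tensor product of A with C over R is the pair (F1, F2). *)
Local Notation AC := (A * A)%type.

Implicit Types (x y s J : A) (z : C) (D : set C) (F : C -> AC) (f : A -> A).

Definition trace x : A := x + aconj x.
Definition nrm x : A := x ** aconj x.

Definition quadratic_cone : set A :=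
  [set x | (exists a : R, x = a *: 1A) \/
           (exists a b : R,
              [/\ trace x = a *: 1A, nrm x = b *: 1A & a ^+ 2 < 4 * b])].

Definition imag_units : set A :=
  [set J | quadratic_cone J /\ J ** J = - 1A].

(* ||x|| = sqrt (n x) on the quadratic cone, where n x is a real number. *)
Definition norm_compatible : Prop :=
  forall x (b : R),
    quadratic_cone x -> nrm x = b *: 1A -> `|x| = Num.sqrt b.

Definition conj_invariant D : Prop := forall z, D z -> D (z.1, - z.2).

Definition circular D : set A :=
  [set x | exists (a b : R) J,
             [/\ D (a, b), imag_units J & x = a *: 1A + b *: J]].

(* Maps defined on D (resp. on circular D) are total functions of which only
   the values on D (resp. on circular D) matter. *)
Definition stem_function D F : Prop :=
  forall z, D z ->
    (F (z.1, - z.2)).1 = (F z).1 /\ (F (z.1, - z.2)).2 = - (F z).2.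

(* The slice function induced by F; lemma slice_ofE below shows that the value
   does not depend on the representation x = a + b J. *)
Definition slice_of F x : A :=
  get [set v | exists (a b : R) J,
         [/\ imag_units J, x = a *: 1A + b *: J
           & v = (F (a, b)).1 + J ** (F (a, b)).2]].

Definition slice_function D f : Prop :=
  exists2 F, stem_function D F & forall x, circular D x -> f x = slice_of F x.

Definition tens_i (w : AC) : AC := (- w.2, w.1).
Definition tens_mul (v w : AC) : AC :=
  (v.1 ** w.1 - v.2 ** w.2, v.1 ** w.2 + v.2 ** w.1).
Definition tens_exp (w : AC) (n : nat) : AC := iter n (tens_mul w) (1A, 0).
Definition tens_of_C z : AC := (z.1 *: 1A, z.2 *: 1A).
Definition tens_of_A x : AC := (x, 0).

Definition partial_alpha F : C -> AC := 'D_((1, 0) : C) F.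
Definition partial_beta F : C -> AC := 'D_((0, 1) : C) F.

Definition class_C1 D F : Prop :=
  forall z, D z ->
    [/\ derivable F z (1, 0), derivable F z (0, 1),
        {for z, continuous (partial_alpha F)}
      & {for z, continuous (partial_beta F)}].

Definition dbar F z : AC :=
  2^-1 *: (partial_alpha F z + tens_i (partial_beta F z)).

Definition slice_regular D f : Prop :=
  exists F, [/\ stem_function D F, class_C1 D F,
                forall z, D z -> dbar F z = 0
              & forall x, circular D x -> f x = slice_of F x].

Definition Delta y x : A := x ** x - x ** trace y + nrm y.

Definition Delta_stem y z : AC :=
  tens_mul (tens_of_C z) (tens_of_C z)
  - tens_mul (tens_of_C z) (tens_of_A (trace y)) + tens_of_A (nrm y).

Definition spherical_stem y (n : nat) z : AC :=
  if odd n
  then tens_mul (tens_exp (Delta_stem y z) n./2) (tens_of_C z - tens_of_A y)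
  else tens_exp (Delta_stem y z) n./2.

(* The general term S_{y,n}(x) s of a spherical series. *)
Definition spherical_term y (n : nat) s x : A :=
  slice_of (fun z => tens_mul (spherical_stem y n z) (tens_of_A s)) x.

Definition udist x y : R := Num.sqrt `|Delta y x|.

Definition uball y (r : R) : set A :=
  [set x | quadratic_cone x /\ udist x y < r].

Definition spherically_analytic (V : set A) f : Prop :=
  forall y, V y -> exists (r : R) (s : nat -> A),
    [/\ uball y r !=set0, uball y r `<=` V
      & forall x, (uball y r `&` V) x ->
          series (fun n => spherical_term y n (s n) x) @ \oo --> f x].

End Definitions.
Arguments imag_units {R} A.
Arguments quadratic_cone {R} A.
Arguments norm_compatible {R} A.
Arguments circular {R} A D.
Arguments conj_invariant {R} D.

Section SliceValue.
Variables (R : realType) (A : normedAltStarAlgType R).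
Local Notation "x ** y" := (@amul R A x y) (at level 40, left associativity).
Local Notation "1A" := (@aone R A).
Implicit Types (x y J : A) (a b c : R).

Lemma aconj1 : aconj 1A = 1A.
Proof. by have := aconjM (aconj 1A) 1A; rewrite amulx1 aconjK amulx1. Qed.

Lemma scaler1_inj a b : a *: 1A = b *: 1A -> a = b.
Proof.
move=> /eqP; rewrite -subr_eq0 -scalerBl scaler_eq0 (negbTE aone_neq0).
by rewrite orbF subr_eq0 => /eqP.
Qed.

Lemma amulNr x y : x ** (- y) = - (x ** y).
Proof. by rewrite -scaleN1r amulZr scaleN1r. Qed.

Lemma amulNl x y : (- x) ** y = - (x ** y).
Proof. by rewrite -scaleN1r amulZl scaleN1r. Qed.

Lemma imag_unit_not_real J a : imag_units A J -> J <> a *: 1A.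
Proof.
move=> [_ JJ] Ja; move: JJ; rewrite Ja amulZl amulZr amul1x scalerA -scaleN1r.
move=> /scaler1_inj aa; have := sqr_ge0 a.
by rewrite expr2 aa ler0N1.
Qed.

Lemma imag_unit_conj J : imag_units A J -> aconj J = - J.
Proof.
move=> JS; have [[[a Ja]|[a [b [tJ nJ _]]]] JJ] := JS.
  by case: (imag_unit_not_real JS Ja).
have cJ : aconj J = a *: 1A - J by rewrite -tJ /trace addrC addKr.
suff a0 : a = 0 by rewrite cJ a0 scale0r add0r.
apply/eqP/negPn/negP => a0.
apply: (@imag_unit_not_real J (a^-1 * (b - 1)) JS).
have aJ : a *: J = (b - 1) *: 1A.
  move: nJ; rewrite /nrm cJ amulDr amulNr amulZr amulx1 JJ opprK => aJ1.
  by rewrite scalerBl scale1r -aJ1 addrK.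
by rewrite -scalerA -aJ scalerA mulVf// scale1r.
Qed.

Lemma imag_rep_inj a b J a' b' J' : imag_units A J -> imag_units A J' ->
  a *: 1A + b *: J = a' *: 1A + b' *: J' ->
  a = a' /\ [\/ b = b' /\ J = J', b = - b' /\ J = - J' | b = 0 /\ b' = 0].
Proof.
move=> JS JS' e.
have := congr1 aconj e; rewrite !aconjD !aconjZ aconj1 !imag_unit_conj// => e'.
have aa : a = a'.
  apply: (@mulfI _ 2%:R); first by rewrite pnatr_eq0.
  apply: scaler1_inj; rewrite !mulr_natl !mulr2n !scalerDl.
  have := congr2 +%R e e'.
  by rewrite !scalerN [LHS]addrACA subrr addr0 [RHS]addrACA subrr addr0.
split=> //; move: e; rewrite aa => /addrI bJ.
have : b ^+ 2 = b' ^+ 2.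
  have := congr2 (@amul R A) bJ bJ.
  rewrite !amulZl !amulZr JS.2 JS'.2 !scalerA !scalerN => /oppr_inj.
  by move/scaler1_inj; rewrite -!expr2.
move/eqP; rewrite eqf_sqr; have [b0|b0] := eqVneq b 0.
  move=> _; apply: Or33; split=> //; apply/eqP; move/esym/eqP: bJ.
  rewrite b0 scale0r scaler_eq0 => /orP[//|/eqP J0].
  by case: (@imag_unit_not_real _ 0 JS'); rewrite scale0r.
case/orP=> /eqP bb.
  apply: Or31; split=> //; apply: (scalerI b0); by rewrite bJ bb.
apply: Or32; split=> //; apply: (scalerI b0).
by rewrite bJ bb scalerN scaleNr opprK.
Qed.

Lemma slice_ofE (D : set (R * R)) (F : R * R -> A * A) a b J :
  stem_function D F -> D (a, b) -> imag_units A J ->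
  slice_of F (a *: 1A + b *: J) = (F (a, b)).1 + J ** (F (a, b)).2.
Proof.
move=> stF Dab JS; rewrite /slice_of.
set P := (X in get X).
have : P (get P) by apply: (@getPex _ P); exists ((F (a, b)).1 + J ** (F (a, b)).2), a, b, J.
move=> [a' [b' [J' [JS' e ->]]]].
have [/= F1 F2] := stF _ Dab.
have [<- [[<- <-//]|[bb JJ]|[b0 b0']]] := imag_rep_inj JS JS' e.
  have -> : b' = - b by rewrite bb opprK.
  have -> : J' = - J by rewrite JJ opprK.
  by rewrite F1 F2 amulNr amulNl opprK.
move: F2; rewrite b0 b0' oppr0 => /eqP; rewrite -addr_eq0 -mulr2n.
rewrite -scaler_nat scaler_eq0 pnatr_eq0/= => /eqP ->.
have amulx0 x : x ** 0 = 0 by rewrite -[X in _ ** X](scale0r 1A) amulZr scale0r.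
by rewrite !amulx0.
Qed.

End SliceValue.

(* Main.v *)
(* In coordinates of A, a holomorphic stem function becomes complex functions g
   with g (conj z) = conj (g z).  The mean value theorem and the Cauchy-Riemann
   equations give a uniform first-order expansion of g on a disc, and a Cauchy
   formula for means over roots of unity turns it into a Taylor series at
   z0 = al + i be.

   For be > 0, dividing this series repeatedly by
   Delta (z) = (z - z0) (z - conj z0), with remainders of degree 1, gives
   g = sum_j Delta ^ j (a_j + z b_j).  The symmetry of g makes a_j and b_j real,
   and each division costs only a bounded factor, whence convergence for small
   Delta.  For be = 0 the Taylor series itself has this form.  As
   a_j + z b_j = (a_j + y b_j) + (z - y) b_j, this is a spherical series.

   Conversely, convergence of a spherical series at J and - J gives convergence
   of its stem, hence geometric bounds on the coefficients; in the variable Delta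
   the stem is then a pair of power series, thus holomorphic. *)

Require Import Defs.
From HB Require Import structures.
From mathcomp Require Import all_boot all_order all_algebra.
From mathcomp Require Import all_classical all_reals all_analysis.
From mathcomp Require Import complex ring lra.

Set Implicit Arguments.
Unset Strict Implicit.
Unset Printing Implicit Defensive.

Import Order.TTheory GRing.Theory Num.Theory.
Import numFieldNormedType.Exports.

Local Open Scope classical_set_scope.
Local Open Scope ring_scope.

(** * The modulus of complex numbers as an element of [R] *)

Section ComplexModulus.
Variable R : realType.
Local Notation C := R[i].
Implicit Types (z w : C) (x : R).

(** The product of [A] is not associative and the norm is linked to it only on the quadratic cone,
    so the analysis takes place on complex coordinate functions, in the field [R[i]]. The bridge is
    that the elements [cz c 1A] multiply like complex numbers, and that the center [y] of a series
    multiplies a coefficient only once, from the left. This last product mixes the coordinates,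
    hence the estimates must be uniform in them: for the expansions of a regular stem, radii and
    geometric ratios are fixed by the center and the disc, before the function. A stem is only known
    to be of class C1, so the Cauchy formula is obtained from finite means, whose sole analytic
    input is a modulus of differentiability common to all points of a disc. In the converse
    direction, class C1 is derived from a quadratic remainder bound valid for every pair of
    points. *)

Definition cmod z : R := ComplexField.Normc.normc z.

Arguments cmod : simpl never.

Lemma cmodE z : cmod z = Num.sqrt (complex.Re z ^+ 2 + complex.Im z ^+ 2).
Proof. by case: z. Qed.

Lemma cmod_ge0 z : 0 <= cmod z.
Proof. by rewrite cmodE sqrtr_ge0. Qed.

Lemma cmodM z w : cmod (z * w) = cmod z * cmod w.
Proof. exact: ComplexField.Normc.normcM. Qed.

Lemma cmod0 : cmod 0 = 0.
Proof. exact: ComplexField.Normc.normc0. Qed.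

Lemma cmod1 : cmod 1 = 1.
Proof. exact: ComplexField.Normc.normc1. Qed.

Lemma cmodV z : cmod z^-1 = (cmod z)^-1.
Proof. exact: ComplexField.Normc.normcV. Qed.

Lemma cmodX z n : cmod (z ^+ n) = cmod z ^+ n.
Proof.
by elim: n => [|n IH]; rewrite ?expr0 ?cmod1// !exprS cmodM IH.
Qed.

Lemma cmodD z w : cmod (z + w) <= cmod z + cmod w.
Proof. exact: le_normcD. Qed.

Lemma cmodN z : cmod (- z) = cmod z.
Proof. exact: normcN. Qed.

Lemma cmodB z w : cmod (z - w) <= cmod z + cmod w.
Proof. by rewrite -(cmodN w) cmodD. Qed.

Lemma cmodBC z w : cmod (z - w) = cmod (w - z).
Proof. by rewrite -cmodN opprB. Qed.

Lemma cmod_eq0 z : (cmod z == 0) = (z == 0).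
Proof.
apply/eqP/eqP => [|->]; last exact: cmod0.
exact: ComplexField.Normc.eq0_normc.
Qed.

Lemma cmod_gt0 z : (0 < cmod z) = (z != 0).
Proof. by rewrite lt_def cmod_eq0 cmod_ge0 andbT. Qed.

Lemma cmod_real x : cmod x%:C%C = `|x|.
Proof. by rewrite cmodE /= expr0n addr0 sqrtr_sqr. Qed.

Lemma cmod_pos_real (x : R) : 0 <= x -> cmod x%:C%C = x.
Proof. by move=> x0; rewrite cmod_real ger0_norm. Qed.

Lemma cmod_conj z : cmod (z^*)%C = cmod z.
Proof. by case: z => a b; rewrite !cmodE /= sqrrN. Qed.

Lemma Re_le_cmod z : `|complex.Re z| <= cmod z.
Proof. by rewrite cmodE -sqrtr_sqr ler_wsqrtr// lerDl sqr_ge0. Qed.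

Lemma Im_le_cmod z : `|complex.Im z| <= cmod z.
Proof. by rewrite cmodE -sqrtr_sqr ler_wsqrtr// lerDr sqr_ge0. Qed.

Lemma cmod_le_ReIm z : cmod z <= `|complex.Re z| + `|complex.Im z|.
Proof.
case: z => a b; rewrite [complex.Re _]/= [complex.Im _]/=.
have -> : (a +i* b)%C = (a%:C)%C + 'i%C * (b%:C)%C.
  by apply/eqP; rewrite eq_complex /=; apply/andP; split; apply/eqP; ring.
apply: (le_trans (cmodD _ _)); rewrite cmodM !cmod_real lerD2l.
by rewrite cmodE /= expr0n expr1n add0r sqrtr1 mul1r.
Qed.

Lemma cmod_sum (I : Type) (r : seq I) (P : pred I) (F : I -> C) :
  cmod (\sum_(i <- r | P i) F i) <= \sum_(i <- r | P i) cmod (F i).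
Proof.
elim/big_rec2: _ => [|i x z _ le_zx]; first by rewrite cmod0.
by apply: (le_trans (cmodD _ _)); rewrite lerD2l.
Qed.

Lemma cmod_natr n : cmod n%:R = n%:R.
Proof.
by rewrite -(rmorph_nat (real_complex R)) cmod_real normr_nat.
Qed.

Lemma cmod_dist3 z w t : cmod (z - t) <= cmod (z - w) + cmod (w - t).
Proof. by rewrite -{1}(subrK w z) -[_ - _ + _ - _]addrA cmodD. Qed.

End ComplexModulus.
#[export] Hint Extern 0 (is_true (0 <= cmod _)) => exact: cmod_ge0 : core.

(** * Limits of complex sequences and geometric convergence *)

Section ComplexLimits.
Variable R : realType.
Local Notation C := R[i].
Local Notation cmod := (@cmod R).

Lemma real_geometric_cvg (u : nat -> R) (K q : R) : 0 <= q < 1 ->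
  (forall n, `|u n.+1 - u n| <= K * q ^+ n) -> cvgn u.
Proof.
move=> /andP[q0 q1] du.
have K0 : 0 <= K by have := le_trans (normr_ge0 _) (du 0%N); rewrite expr0 mulr1.
have -> : u = (fun n => u 0%N + series (telescope u) n).
  by apply/funext => n; rewrite -eq_sum_telescope.
apply: is_cvgD; first exact: is_cvg_cst.
apply: normed_cvg.
apply: (@series_le_cvg _ _ (geometric K q)) => [n|n|n|].
- exact: normr_ge0.
- by rewrite mulr_ge0// exprn_ge0.
- exact: du.
- by apply: is_cvg_geometric_series; rewrite ger0_norm.
Qed.

(** The filter is a parameter because limits are taken along [\oo] and also along an ultrafilter
    refining it. *)
Definition ccvg (F : set_system nat) (u : nat -> C) (l : C) : Prop :=
  forall e : R, 0 < e -> \forall n \near F, cmod (u n - l) < e.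

Lemma ccvg_ReIm F {FF : Filter F} (u : nat -> C) (l : C) :
  complex.Re (u n) @[n --> F] --> complex.Re l ->
  complex.Im (u n) @[n --> F] --> complex.Im l -> ccvg F u l.
Proof.
move=> /cvgrPdist_lt cr /cvgrPdist_lt ci e e0.
have e20 : 0 < e / 2 by lra.
near=> n; apply: (le_lt_trans (cmod_le_ReIm _)).
have := near (cr _ e20) n; have := near (ci _ e20) n.
move=> /(_ ltac:(by []))h1 /(_ ltac:(by [])) h2.
rewrite !raddfB /= -[X in X + _]normrN -[X in _ + X]normrN !opprB.
by rewrite [ltRHS](splitr e) ltrD//.
Unshelve. all: by end_near.
Qed.

Lemma ccvg_Re F {FF : Filter F} (u : nat -> C) (l : C) :
  ccvg F u l -> complex.Re (u n) @[n --> F] --> complex.Re l.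
Proof.
move=> cu; apply/cvgrPdist_lt => e e0; near=> n.
rewrite distrC -raddfB; apply: le_lt_trans (Re_le_cmod _) _.
by near: n; exact: cu.
Unshelve. all: by end_near.
Qed.

Lemma ccvg_Im F {FF : Filter F} (u : nat -> C) (l : C) :
  ccvg F u l -> complex.Im (u n) @[n --> F] --> complex.Im l.
Proof.
move=> cu; apply/cvgrPdist_lt => e e0; near=> n.
rewrite distrC -raddfB; apply: le_lt_trans (Im_le_cmod _) _.
by near: n; exact: cu.
Unshelve. all: by end_near.
Qed.

Lemma geometric_cauchy (u : nat -> C) (K q : R) : 0 <= q < 1 ->
  (forall n, cmod (u n.+1 - u n) <= K * q ^+ n) ->
  forall n m, cmod (u (n + m)%N - u n) <= K * q ^+ n / (1 - q).
Proof.
move=> /andP[q0 q1] du n m.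
have K0 : 0 <= K by have := le_trans (cmod_ge0 _) (du 0%N); rewrite expr0 mulr1.
have Kq : 0 <= K * q ^+ n by rewrite mulr_ge0// exprn_ge0.
(* The induction on [m] needs the exact geometric sum; the factor [1 - q ^+ m] is dropped only in
   the conclusion. *)
suff h : cmod (u (n + m)%N - u n) * (1 - q) <= K * q ^+ n * (1 - q ^+ m).
  rewrite ler_pdivlMr ?subr_gt0//; apply: (le_trans h).
  by rewrite ler_piMr// gerBl exprn_ge0.
elim: m => [|m IH]; first by rewrite addn0 subrr cmod0 expr0 subrr mulr0 mul0r.
rewrite addnS.
have := cmod_dist3 (u (n + m).+1) (u (n + m)%N) (u n).
have := du (n + m)%N; rewrite exprD exprS mulrA.
have : 0 <= q ^+ m by exact: exprn_ge0.
move: (cmod _) (cmod _) (cmod _) (q ^+ m) (K * q ^+ n) IH Kq => A B D E F.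
nra.
Qed.

Lemma geometric_ccvg (u : nat -> C) (K q : R) : 0 <= q < 1 ->
  (forall n, cmod (u n.+1 - u n) <= K * q ^+ n) ->
  exists l, forall n, cmod (u n - l) <= K * q ^+ n / (1 - q).
Proof.
move=> q01 du.
have cr : cvgn (fun n => complex.Re (u n)).
  apply: (real_geometric_cvg q01) => n; apply: le_trans (du n).
  by rewrite -raddfB; exact: Re_le_cmod.
have ci : cvgn (fun n => complex.Im (u n)).
  apply: (real_geometric_cvg q01) => n; apply: le_trans (du n).
  by rewrite -raddfB; exact: Im_le_cmod.
set l : C := (limn (fun n => complex.Re (u n)) +i* limn (fun n => complex.Im (u n)))%C.
have ul : ccvg \oo u l by apply: ccvg_ReIm.
exists l => n; apply/ler_addgt0Pr => e e0.
have [m _ /(_ (n + m)%N)] := ul _ e0.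
move=> /(_ (leq_addl _ _)) /= h.
apply: (le_trans (cmod_dist3 _ (u (n + m)%N) _)).
by rewrite lerD// ?(ltW h)// cmodBC geometric_cauchy.
Qed.

Lemma cvg_geometric0 (K q : R) : 0 <= q < 1 -> K * q ^+ n @[n --> \oo] --> (0 : R).
Proof.
by move=> /andP[q0 q1]; apply: cvg_geometric; rewrite ger0_norm.
Qed.

Lemma ccvg_le (u : nat -> C) (l : C) (b : nat -> R) :
  (forall n, cmod (u n - l) <= b n) -> b n @[n --> \oo] --> (0 : R) ->
  ccvg \oo u l.
Proof.
move=> ub /cvgrPdist_lt b0 e e0; near=> n.
apply: (le_lt_trans (ub n)); apply: (le_lt_trans (ler_norm _)).
by rewrite -normrN -sub0r; near: n; exact: b0.
Unshelve. all: by end_near.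
Qed.

Lemma ccvg_uniq F {FF : ProperFilter F} (u : nat -> C) l l' :
  ccvg F u l -> ccvg F u l' -> l = l'.
Proof.
move=> ul ul'; apply/eqP; rewrite -subr_eq0 -cmod_eq0 eq_le cmod_ge0 andbT.
apply/ler_addgt0Pr => e e0; rewrite add0r.
have e20 : 0 < e / 2 by lra.
have [n [h h']] := filter_ex (filterI (ul _ e20) (ul' _ e20)).
apply: le_trans (cmod_dist3 _ (u n) _) _; rewrite cmodBC.
by rewrite (splitr e) lerD// ltW.
Qed.

Lemma ccvgB F {FF : Filter F} (u v : nat -> C) l l' :
  ccvg F u l -> ccvg F v l' -> ccvg F (fun n => u n - v n) (l - l').
Proof.
move=> ul vl e e0; have e20 : 0 < e / 2 by lra.
near=> n.
have -> : u n - v n - (l - l') = (u n - l) - (v n - l') by ring.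
apply: (le_lt_trans (cmodB _ _)); rewrite [ltRHS](splitr e) ltrD//.
  by near: n; exact: ul.
by near: n; exact: vl.
Unshelve. all: by end_near.
Qed.

Lemma ccvgMr F {FF : Filter F} (u : nat -> C) l z :
  ccvg F u l -> ccvg F (fun n => u n * z) (l * z).
Proof.
move=> ul e e0; have z0 : 0 < cmod z + 1 by rewrite ltr_wpDl.
near=> n.
rewrite -mulrBl cmodM; apply: (@le_lt_trans _ _ (cmod (u n - l) * (cmod z + 1))).
  by rewrite ler_wpM2l// lerDl.
rewrite -ltr_pdivlMr//; near: n; apply: ul; exact: divr_gt0.
Unshelve. all: by end_near.
Qed.

Lemma ccvg_le_bound F {FF : ProperFilter F} (u : nat -> C) l (c : R) :
  ccvg F u l -> (\forall n \near F, cmod (u n) <= c) -> cmod l <= c.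
Proof.
move=> ul uc; apply/ler_addgt0Pr => e e0.
have [n [h h']] := filter_ex (filterI (ul _ e0) uc).
rewrite -[l]subr0; apply: (le_trans (cmod_dist3 _ (u n) _)).
by rewrite subr0 addrC lerD// cmodBC ltW.
Qed.

Lemma ccvgD F {FF : Filter F} (u v : nat -> C) l l' :
  ccvg F u l -> ccvg F v l' -> ccvg F (fun n => u n + v n) (l + l').
Proof.
move=> ul vl e e0; have e20 : 0 < e / 2 by lra.
near=> n.
rewrite opprD addrACA.
apply: (le_lt_trans (cmodD _ _)); rewrite [ltRHS](splitr e) ltrD//.
  by near: n; exact: ul.
by near: n; exact: vl.
Unshelve. all: by end_near.
Qed.

Lemma ccvg_sum F {FF : Filter F} (u : nat -> nat -> C) (l : nat -> C) n :
  (forall j, ccvg F (u j) (l j)) ->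
  ccvg F (fun N => \sum_(j < n) u j N) (\sum_(j < n) l j).
Proof.
move=> ul; elim: n => [|n IH].
  by move=> e e0; apply: nearW => N; rewrite !big_ord0 subrr cmod0.
move=> e e0; have h := ccvgD IH (ul n) e0.
by near=> N; rewrite !big_ord_recr /=; near: N; exact: h.
Unshelve. all: by end_near.
Qed.

End ComplexLimits.

(** * Complex power series with geometrically bounded coefficients *)

Section PowerSeries.
Variable R : realType.
Local Notation C := R[i].
Local Notation cmod := (@cmod R).
Implicit Types (a : nat -> C) (w h : C) (K L q : R).

Definition psum a w n : C := \sum_(k < n) a k * w ^+ k.
(* Junk value 0 where the series diverges. *)
Definition pser a w : C :=
  xget 0 [set l : C | ccvg \oo (psum a w) l].
Definition dcoef a : nat -> C := fun k => k.+1%:R * a k.+1.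

Lemma psumS a w n : psum a w n.+1 = psum a w n + a n * w ^+ n.
Proof. by rewrite /psum big_ord_recr. Qed.

(** The increments of the partial sums are dominated by a geometric sequence of ratio [L * cmod w],
    which gives the limit and the rate at once. *)
Lemma pser_tail a w K L n : 0 <= L -> (forall k, cmod (a k) <= K * L ^+ k) ->
  L * cmod w < 1 ->
  cmod (psum a w n - pser a w) <= K * (L * cmod w) ^+ n / (1 - L * cmod w).
Proof.
move=> L0 aK Lw.
have q01 : 0 <= L * cmod w < 1 by rewrite Lw andbT mulr_ge0.
have [k|l hl] := @geometric_ccvg _ (psum a w) K _ q01.
  rewrite psumS addrAC subrr add0r cmodM cmodX exprMn mulrA.
  by rewrite ler_wpM2r// exprn_ge0.
have cl : ccvg \oo (psum a w) l.
  apply: (ccvg_le hl); under eq_fun do rewrite mulrAC.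
  exact: cvg_geometric0.
suff -> : pser a w = l by [].
by apply: (@ccvg_uniq _ \oo _ (psum a w)) => //; apply: (@xgetPex _ 0 [set l : C | ccvg \oo (psum a w) l]); exists l.
Qed.

Lemma pser_cvg a w K L : 0 <= L -> (forall k, cmod (a k) <= K * L ^+ k) ->
  L * cmod w < 1 -> ccvg \oo (psum a w) (pser a w).
Proof.
move=> L0 aK Lw.
apply: (ccvg_le (fun n => pser_tail n L0 aK Lw)).
under eq_fun do rewrite mulrAC.
by apply: cvg_geometric0; rewrite Lw andbT mulr_ge0.
Qed.

(** The quotient of [L ^+ n - q ^+ n] by [L - q] is a sum of [n] monomials, each at least
    [q ^+ n.-1]. This absorbs the factor that differentiation brings in front of a coefficient. *)
Lemma natr_expr_le q L n : 0 <= q -> q <= L ->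
  n%:R * q ^+ n * (L - q) <= q * L ^+ n.
Proof.
move=> q0 qL; suff h : n%:R * q ^+ n.-1 * (L - q) <= L ^+ n - q ^+ n.
  case: n h => [|n] h; first by rewrite !mul0r mulr_ge0// exprn_ge0// (le_trans q0).
  rewrite [in leLHS]exprS mulrCA -!mulrA ler_wpM2l// mulrA (le_trans h)//.
  by rewrite gerBl exprn_ge0.
elim: n => [|n IH]; first by rewrite !mul0r !expr0 subrr.
have L0 := le_trans q0 qL.
have : n%:R * q ^+ n * (L - q) <= L * (L ^+ n - q ^+ n).
  case: n IH => [|n] IH; first by rewrite !mul0r expr0 expr0 subrr mulr0.
  have -> : n.+1%:R * q ^+ n.+1 * (L - q) = q * (n.+1%:R * q ^+ n * (L - q)) by rewrite exprS; ring.
  apply: ler_pM => //.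
  by rewrite !mulr_ge0 ?exprn_ge0 ?subr_ge0.
rewrite -natr1 !exprS; move: (q ^+ n) (L ^+ n) => A B.
nra.
Qed.

(** Differentiation keeps a geometric bound, at the price of an arbitrarily small increase of the
    ratio. *)
Lemma dcoef_bound a K L L' : 0 <= L -> L < L' ->
  (forall k, cmod (a k) <= K * L ^+ k) ->
  forall k, cmod (dcoef a k) <= (K * L * L' / (L' - L)) * L' ^+ k.
Proof.
move=> L0 LL' aK k; rewrite /dcoef cmodM cmod_natr.
have K0 : 0 <= K by have := le_trans (cmod_ge0 _) (aK 0%N); rewrite expr0 mulr1.
apply: (@le_trans _ _ (k.+1%:R * (K * L ^+ k.+1))); first by rewrite ler_wpM2l.
have -> : K * L * L' / (L' - L) * L' ^+ k = K * (L * L' ^+ k.+1 / (L' - L)).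
  by rewrite exprS; ring.
rewrite mulrCA ler_wpM2l// ler_pdivlMr ?subr_gt0//.
by apply: natr_expr_le => //; exact: ltW.
Qed.

(* Telescoping: [(x k^2 + y k + z) q^k] decreases by at least [k^2 q^k]. *)
Lemma sum_sqr_expr_bound q : 0 <= q < 1 ->
  exists S : R, forall n, \sum_(k < n) k%:R ^+ 2 * q ^+ k <= S.
Proof.
move=> /andP[q0 q1]; set x := (1 - q)^-1.
have x0 : 0 < x by rewrite invr_gt0 subr_gt0.
have xq : x * (1 - q) = 1 by rewrite mulVf// gt_eqF// subr_gt0.
(* Up to the factor [q ^+ k], the decrease is a polynomial in [k] with coefficients [x (1 - q)],
   [y (1 - q) - 2 q x] and [z (1 - q) - q (x + y)]. These choices make the first one 1 and the other
   two nonnegative. *)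
set y := 2 * x ^+ 2; set z := (x + y) * x.
have T k : 0 <= (x * k%:R ^+ 2 + y * k%:R + z) * q ^+ k.
  by rewrite mulr_ge0 ?exprn_ge0// !addr_ge0// !mulr_ge0// ?ltW// ?addr_gt0 ?mulr_gt0 ?exprn_gt0.
exists z => n.
suff : \sum_(k < n) k%:R ^+ 2 * q ^+ k <= z - (x * n%:R ^+ 2 + y * n%:R + z) * q ^+ n.
  by move=> h; apply: (le_trans h); rewrite gerBl.
elim: n => [|n IH].
  by rewrite big_ord0 expr0 mulr1 expr0n !mulr0 !add0r subrr.
rewrite big_ord_recr /=; apply: (le_trans (lerD IH (lexx _))).
rewrite -addrA lerD2l -subr_ge0 [q ^+ n.+1]exprS.
rewrite [leRHS](_ : _ =
  q ^+ n * ((x * (1 - q) - 1) * n%:R ^+ 2 + (y * (1 - q) - 2 * q * x) * n%:R +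
    (z * (1 - q) - q * (x + y)))); last by rewrite -[n.+1%:R]natr1; ring.
have yq : y * (1 - q) = 2 * x by rewrite /y -mulrA expr2 -mulrA xq mulr1.
have zq : z * (1 - q) = x + y by rewrite /z -mulrA xq mulr1.
rewrite xq yq zq subrr mul0r add0r mulr_ge0 ?exprn_ge0// addr_ge0//.
  rewrite mulr_ge0// subr_ge0; move: x0 q1 q0; nra.
have xy : 0 < x + y by rewrite addr_gt0// mulr_gt0// exprn_gt0.
by move: xy q1 q0; nra.
Qed.

(** The remainder [r n] satisfies [r n.+1 = h * r n + n%:R * w ^+ n.-1 * (h - w) ^+ 2], and the
    bound closes by [n ^ 2 + n + (n + 1) = (n + 1) ^ 2]. The factor [t ^+ 2] on the left avoids the
    exponent [n - 2]. *)
Lemma expr_quad w h (t : R) n : cmod w <= t -> cmod h <= t ->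
  cmod (h ^+ n - w ^+ n - n%:R * w ^+ n.-1 * (h - w)) * t ^+ 2 <=
    n%:R ^+ 2 * t ^+ n * cmod (h - w) ^+ 2.
Proof.
move=> wt ht; have t0 : 0 <= t by exact: le_trans wt.
elim: n => [|n IH]; first by rewrite !mul0r subr0 !expr0 subrr cmod0 expr0n !mul0r.
have -> : h ^+ n.+1 - w ^+ n.+1 - n.+1%:R * w ^+ n.+1.-1 * (h - w) =
   h * (h ^+ n - w ^+ n - n%:R * w ^+ n.-1 * (h - w)) +
   n%:R * w ^+ n.-1 * (h - w) ^+ 2.
  case: n {IH} => [|n]; first by rewrite /= !expr0; ring.
  rewrite -[n.+2.-1]/(n.+1) -[n.+1.-1]/n -[n.+2%:R]natr1.
  by rewrite [h ^+ n.+2]exprS [w ^+ n.+2]exprS [w ^+ n.+1]exprS; ring.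
apply: (le_trans (ler_wpM2r (sqr_ge0 t) (cmodD _ _))).
rewrite !cmodM mulrDl.
have -> : n.+1%:R ^+ 2 * t ^+ n.+1 * cmod (h - w) ^+ 2 =
  t * (n%:R ^+ 2 * t ^+ n * cmod (h - w) ^+ 2) +
   ((n%:R * (t ^+ n.+1) * cmod (h - w) ^+ 2) + n.+1%:R * t ^+ n.+1 * cmod (h - w) ^+ 2).
  by rewrite -[n.+1%:R]natr1 [t ^+ n.+1]exprS; ring.
have D0 : 0 <= cmod (h - w) ^+ 2 by exact: sqr_ge0.
rewrite lerD//.
  by rewrite -[leLHS]mulrA ler_pM// mulr_ge0// sqr_ge0.
apply: ler_wpDr; first by rewrite !mulr_ge0 ?exprn_ge0.
rewrite cmod_natr !cmodX mulrAC ler_wpM2r//.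
case: n {IH} => [|n]; first by rewrite !mul0r.
rewrite -[leLHS]mulrA; apply: ler_wpM2l => //; rewrite -[n.+1.-1]/n -[n.+2]addn2 exprD ler_wpM2r ?sqr_ge0//.
by rewrite lerXn2r// nnegrE.
Qed.

End PowerSeries.

(** * Quadratic remainder bounds for series in a quadratic polynomial *)

Section QuadraticRemainder.
Variable R : realType.
Local Notation C := R[i].
Local Notation cmod := (@cmod R).
Implicit Types (a b : nat -> C) (w h z p q T M : C) (K L : R).

(** On an open [U] this makes [f'] the derivative of [f]; being required of both [(p, q)] and
    [(q, p)], it also makes [f'] Lipschitz. It thus carries class C1 in a form that is stable under
    limits, sums and composition. *)
Definition quad_on (U : C -> Prop) (f f' : C -> C) (B : R) : Prop :=
  forall p q, U p -> U q ->
    cmod (f q - f p - f' p * (q - p)) <= B * cmod (q - p) ^+ 2.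

(** The tail bound at rank 0, where the partial sum vanishes. *)
Lemma pser_bound a K L (t : R) w : 0 <= L -> 
  (forall k, cmod (a k) <= K * L ^+ k) -> L * t < 1 -> cmod w <= t ->
  cmod (pser a w) <= K / (1 - L * t).
Proof.
move=> L0 aK Lt wt.
have K0 : 0 <= K by have := le_trans (cmod_ge0 _) (aK 0%N); rewrite expr0 mulr1.
have Lwt : L * cmod w <= L * t by rewrite ler_wpM2l.
have Lw : L * cmod w < 1 by exact: le_lt_trans Lt.
have := pser_tail 0 L0 aK Lw.
rewrite /psum big_ord0 sub0r cmodN expr0 mulr1 => h; apply: (le_trans h).
by rewrite ler_wpM2l// lef_pV2 ?posrE ?subr_gt0// lerB.
Qed.

(** Sum [expr_quad] over the terms: the series of [k ^ 2 (L t) ^ k] is bounded, and the inequality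
    passes to the limit. [B] is chosen before [a], so that it serves all coordinates of a stem. *)
Lemma pser_quad K L (t : R) : 0 <= L -> 0 < t -> L * t < 1 ->
  exists B, forall a, (forall k, cmod (a k) <= K * L ^+ k) ->
    quad_on (fun w => cmod w <= t) (pser a) (pser (dcoef a)) B.
Proof.
move=> L0 t0 Lt.
have q01 : 0 <= L * t < 1 by rewrite Lt andbT mulr_ge0// ltW.
have [S hS] := sum_sqr_expr_bound q01.
have t20 : 0 < t ^+ 2 by rewrite exprn_gt0.
exists (K * S / t ^+ 2) => a aK w h wt ht.
have K0 : 0 <= K by have := le_trans (cmod_ge0 _) (aK 0%N); rewrite expr0 mulr1.
have Lx x : cmod x <= t -> L * cmod x < 1.
  by move=> xt; apply: le_lt_trans Lt; rewrite ler_wpM2l.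
(* A ratio between [L] and [t^-1]: the derived series still converges for [cmod w <= t]. *)
set L' := (L + t^-1) / 2.
have tV : L < t^-1 by rewrite -[t^-1]mul1r ltr_pdivlMr.
have LL' : L < L' by rewrite /L'; lra.
have L't : L' * t < 1 by rewrite -ltr_pdivlMr// mul1r /L'; lra.
have L'0 : 0 <= L' by exact: le_trans (ltW LL').
have aK' := dcoef_bound L0 LL' aK.
have L'w : L' * cmod w < 1 by apply: le_lt_trans L't; rewrite ler_wpM2l.
have c1 := ccvgB (pser_cvg L0 aK (Lx _ ht)) (pser_cvg L0 aK (Lx _ wt)).
(* The first [n] terms of the derived series correspond to the first [n + 1] terms of the series. *)
have c1' : ccvg \oo (fun n => psum a h n.+1 - psum a w n.+1) (pser a h - pser a w).
  move=> e e0; have [N _ hN] := c1 _ _ e0.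
  by exists N => // n /= Nn; apply: hN => /=; exact: leqW.
have c2 := ccvgMr (h - w) (pser_cvg L'0 aK' L'w).
apply: (ccvg_le_bound (ccvgB c1' (c2 _))); apply: nearW => n.
rewrite mulrAC ler_pdivlMr//.
have -> : psum a h n.+1 - psum a w n.+1 - psum (dcoef a) w n * (h - w) =
  \sum_(k < n.+1) a k * (h ^+ k - w ^+ k - k%:R * w ^+ k.-1 * (h - w)).
  under eq_bigr do rewrite mulrBr mulrBr; rewrite !sumrB.
  congr (_ - _); rewrite big_ord_recl /= !mul0r mulr0 add0r mulr_suml.
  by apply: eq_bigr => i _; rewrite /dcoef /bump /=; ring.
apply: (@le_trans _ _ (\sum_(k < n.+1) K * (k%:R ^+ 2 * (L * t) ^+ k) * cmod (h - w) ^+ 2)); last first.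
  by rewrite -mulr_suml -mulr_sumr ler_wpM2r ?sqr_ge0// ler_wpM2l.
apply: (le_trans (ler_wpM2r (ltW t20) (cmod_sum _ _ _))).
rewrite mulr_suml; apply: ler_sum => k _.
rewrite cmodM -[leLHS]mulrA.
apply: (le_trans (ler_wpM2l (cmod_ge0 _) (expr_quad k wt ht))).
have -> : K * (k%:R ^+ 2 * (L * t) ^+ k) * cmod (h - w) ^+ 2 =
  (K * L ^+ k) * (k%:R ^+ 2 * t ^+ k * cmod (h - w) ^+ 2) by rewrite exprMn; ring.
apply: ler_wpM2r (aK k); exact: mulr_ge0 (mulr_ge0 (sqr_ge0 _) (exprn_ge0 _ (ltW t0))) (sqr_ge0 _).
Qed.

Definition qpoly T M z : C := z ^+ 2 - z * T + M.
(** The sum of [P ^ j (a j + z * b j)] with [P = qpoly T M z], the form taken by a spherical series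
    when its terms are grouped in pairs. *)
Definition qser a b T M z : C := pser a (qpoly T M z) + z * pser b (qpoly T M z).

Lemma quadD U f f' g g' B B' : quad_on U f f' B -> quad_on U g g' B' ->
  quad_on U (fun z => f z + g z) (fun z => f' z + g' z) (B + B').
Proof.
move=> hf hg p q Up Uq; rewrite [leRHS]mulrDl.
have -> : f q + g q - (f p + g p) - (f' p + g' p) * (q - p) =
  (f q - f p - f' p * (q - p)) + (g q - g p - g' p * (q - p)) by ring.
by apply: (le_trans (cmodD _ _)); rewrite lerD ?hf ?hg.
Qed.

Lemma quadX U f f' B (Q D : R) : quad_on U f f' B ->
  (forall p, U p -> cmod p <= Q) -> (forall p, U p -> cmod (f' p) <= D) ->
  0 <= B ->
  quad_on U (fun z => z * f z) (fun z => f z + z * f' z) (Q * B + D).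
Proof.
move=> hf hQ hD B0 p q Up Uq.
have -> : q * f q - p * f p - (f p + p * f' p) * (q - p) =
  q * (f q - f p - f' p * (q - p)) + f' p * (q - p) ^+ 2 by ring.
apply: (le_trans (cmodD _ _)); rewrite !cmodM mulrDl -mulrA lerD//.
  by rewrite ler_pM ?hQ ?hf.
by rewrite -expr2 ler_wpM2r ?sqr_ge0// hD.
Qed.

(** The second-order part of [qpoly] is exactly [(q - p) ^+ 2], which contributes [D]. The rest is
    the bound for [f], at an increment at most [2 * Q + cmod T] times larger than [q - p]. *)
Lemma quad_comp U f f' B T M (Q D t : R) :
  quad_on (fun w => cmod w <= t) f f' B -> 0 <= B -> 
  (forall p, U p -> cmod p <= Q) -> (forall p, U p -> cmod (qpoly T M p) <= t) ->
  (forall p, cmod p <= t -> cmod (f' p) <= D) ->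
  quad_on U (fun z => f (qpoly T M z)) (fun z => f' (qpoly T M z) * (2 * z - T))
    (B * (2 * Q + cmod T) ^+ 2 + D).
Proof.
move=> hf B0 hQ ht hD p q Up Uq.
set P := qpoly T M p; set P' := qpoly T M q.
have PP : P' - P = (q - p) * (q + p - T) by rewrite /P /P' /qpoly; ring.
have -> : f P' - f P - f' P * (2 * p - T) * (q - p) =
  (f P' - f P - f' P * (P' - P)) + f' P * (q - p) ^+ 2 by rewrite PP; ring.
apply: (le_trans (cmodD _ _)); rewrite mulrDl lerD//; last first.
  by rewrite cmodM cmodX ler_wpM2r ?sqr_ge0// hD// ht.
apply: (le_trans (hf _ _ (ht _ Up) (ht _ Uq))).
rewrite -mulrA ler_wpM2l// -exprMn lerXn2r// ?nnegrE//.
  by rewrite mulr_ge0// addr_ge0// mulr_ge0// (le_trans _ (hQ _ Up)).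
rewrite PP cmodM mulrC ler_wpM2r//.
apply: (le_trans (cmodB _ _)); rewrite lerD2r (le_trans (cmodD _ _))//.
by rewrite [2 * Q]mulr_natl mulr2n lerD ?hQ.
Qed.

Lemma quad_onW U f f' B B' : B <= B' -> quad_on U f f' B -> quad_on U f f' B'.
Proof.
move=> BB hf p q Up Uq; apply: (le_trans (hf p q Up Uq)).
by rewrite ler_wpM2r ?sqr_ge0.
Qed.

(** [d] and [B] come before the coefficients, so that one disc serves all coordinates of a stem. *)
Lemma qser_quad T M K L z : 0 <= L -> L * cmod (qpoly T M z) < 1 ->
  exists d B : R, [/\ 0 < d, 0 <= B & forall a b,
    (forall k, cmod (a k) <= K * L ^+ k) -> (forall k, cmod (b k) <= K * L ^+ k) ->
    exists f' : C -> C, quad_on (fun p => cmod (p - z) < d) (qser a b T M) f' B].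
Proof.
move=> L0 Lz.
(* A radius strictly larger than the value at [z], but still inside the disc of convergence, leaves
   room for a neighborhood of [z]. *)
have [t t1 Lt] : exists2 t : R, cmod (qpoly T M z) < t & L * t < 1.
  set m := cmod _ in Lz *.
  have [L00|L00] := eqVneq L 0; first by exists (m + 1); rewrite ?L00 ?mul0r// ltrDl.
  have Lp : 0 < L by rewrite lt_def L00.
  have mL : m < L^-1 by rewrite -[L^-1]mul1r ltr_pdivlMr// mulrC.
  by exists ((m + L^-1) / 2); [lra|rewrite mulrC -ltr_pdivlMr// mul1r; lra].
have t0 : 0 < t by exact: le_lt_trans t1.
have [B0 hB0] := pser_quad K L0 t0 Lt.
set L' := (L + t^-1) / 2.
have tV : L < t^-1 by rewrite -[t^-1]mul1r ltr_pdivlMr.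
have LL' : L < L' by rewrite /L'; lra.
have L't : L' * t < 1 by rewrite -ltr_pdivlMr// mul1r /L'; lra.
have L'0 : 0 <= L' by exact: le_trans (ltW LL').
set K' := K * L * L' / (L' - L).
set D := K' / (1 - L' * t).
set m := cmod (qpoly T M z) in t1.
(* [G] bounds [cmod (p + z - T)] for [p] at distance at most 1 from [z]; a displacement below
   [(t - m) / G] therefore keeps [cmod (qpoly T M p)] below [t]. *)
set G := 2 * cmod z + 1 + cmod T.
have G0 : 0 < G by rewrite /G; have := cmod_ge0 z; have := cmod_ge0 T; lra.
set d := Num.min 1 ((t - m) / G).
have d0 : 0 < d by rewrite lt_min ltr01 divr_gt0// subr_gt0.
set U := fun p => cmod (p - z) < d.
have UQ p : U p -> cmod p <= cmod z + 1.
  rewrite /U lt_min => /andP[p1 _].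
  by rewrite -[p](subrK z) addrC (le_trans (cmodD _ _))// lerD2l ltW.
have Ut p : U p -> cmod (qpoly T M p) <= t.
  move=> Up; rewrite -[qpoly T M p](subrK (qpoly T M z)).
  apply: (le_trans (cmodD _ _)); rewrite -lerBrDr.
  have -> : qpoly T M p - qpoly T M z = (p - z) * (p + z - T) by rewrite /qpoly; ring.
  rewrite cmodM; apply: (@le_trans _ _ (d * G)).
    apply: ler_pM => //; first exact: ltW.
    rewrite (le_trans (cmodB _ _))// lerD2r.
    by rewrite (le_trans (cmodD _ _))//; have := UQ _ Up; lra.
  by rewrite -ler_pdivlMr// ge_min lexx orbT.
set Q := cmod z + 1 in UQ.
set E := `|B0| * (2 * Q + cmod T) ^+ 2 + D.
set E' := D * (2 * Q + cmod T).
exists d, `|E + (Q * `|E| + E')|; split; [exact: d0|exact: normr_ge0|].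
move=> a b aK bK.
have aK' := dcoef_bound L0 LL' aK.
have bK' := dcoef_bound L0 LL' bK.
have Q1 := quad_comp (quad_onW (ler_norm B0) (hB0 _ aK)) (normr_ge0 _) UQ Ut
  (fun p => pser_bound L'0 aK' L't).
have Q2 := quad_comp (quad_onW (ler_norm B0) (hB0 _ bK)) (normr_ge0 _) UQ Ut
  (fun p => pser_bound L'0 bK' L't).
have hD p : U p -> cmod (pser (dcoef b) (qpoly T M p) * (2 * p - T)) <= E'.
  move=> Up; rewrite cmodM ler_pM ?(pser_bound L'0 bK' L't) ?Ut//.
  rewrite (le_trans (cmodB _ _))// lerD2r cmodM cmod_natr ler_wpM2l//.
  exact: UQ.
have Q2' := quadX (quad_onW (ler_norm _) Q2) UQ hD (normr_ge0 _).
eexists; exact: (quad_onW (ler_norm _) (quadD Q1 Q2')).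
Qed.

End QuadraticRemainder.

(** * Roots of unity and limits along ultrafilters *)

Section RootsOfUnity.
Variable R : realType.
Local Notation C := R[i].
Local Notation cmod := (@cmod R).

Definition cis (t : R) : C := (cos t +i* sin t)%C.

Lemma cisD s t : cis (s + t) = cis s * cis t.
Proof. by apply/eqP; rewrite eq_complex /= cosD sinD addrC eqxx/= addrC; apply/eqP; ring. Qed.

Lemma cis0 : cis 0 = 1.
Proof. by rewrite /cis cos0 sin0. Qed.

Lemma cisMn t n : cis (t *+ n) = cis t ^+ n.
Proof. by elim: n => [|n IH]; rewrite ?mulr0n ?cis0// mulrS cisD IH exprS. Qed.

Lemma cmod_cis t : cmod (cis t) = 1.
Proof. by rewrite cmodE /= cos2Dsin2 sqrtr1. Qed.

(** The real part is [1 - 2 sin (t / 2) ^ 2], and [t / 2] lies strictly between 0 and [pi]. *)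
Lemma cis_neq1 t : 0 < t < pi *+ 2 -> cis t != 1.
Proof.
move=> /andP[t0 t2]; apply/eqP => /(congr1 (@complex.Re R)) /= ct.
have : 0 < sin (t / 2).
  by apply: sin_gt0_pi; move: t0 t2; rewrite mulr2n => *; apply/andP; split; lra.
move: ct; rewrite {1}(splitr t) -mulr2n cos_mulr2n cos2sin2 => h s0.
have : 0 < sin (t / 2) ^+ 2 by rewrite exprn_gt0.
by move: h; rewrite mulr2n; lra.
Qed.

Definition unity (n : nat) : C := cis (pi *+ 2 / n%:R).

Lemma unity_expr n : (0 < n)%N -> unity n ^+ n = 1.
Proof.
move=> n0; rewrite -cisMn -[_ *+ n]mulr_natr mulfVK ?pnatr_eq0 -?lt0n//.
by rewrite /cis cos2pi mulr2n sinD sinpi mul0r mulr0 addr0.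
Qed.

Lemma unity_prim n j : (0 < j < n)%N -> unity n ^+ j != 1.
Proof.
move=> /andP[j0 jn]; rewrite -cisMn; apply: cis_neq1.
have n0 : 0 < n%:R :> R by rewrite ltr0n (leq_trans _ jn).
have p0 : 0 < (pi : R) *+ 2 by rewrite mulrn_wgt0// pi_gt0.
rewrite -[_ *+ j]mulr_natr mulrAC; apply/andP; split.
  by rewrite divr_gt0// mulr_gt0// ltr0n.
by rewrite ltr_pdivrMr// ltr_pM2l// ltr_nat.
Qed.

(** The side of the regular polygon tends to 0, so that neighboring nodes eventually fall within any
    given modulus of differentiability. *)
Lemma unity_cvg1 : ccvg \oo unity 1.
Proof.
have h0 : pi *+ 2 / n%:R @[n --> \oo] --> (0 : R).
  rewrite -[X in _ --> X](mulr0 (pi *+ 2)); apply: cvgM; first exact: cvg_cst.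
  by apply/gtr0_cvgV0; [near=> n; rewrite ltr0n; near: n; exact: nbhs_infty_gt|exact: cvgr_idn].
apply: ccvg_ReIm => /=.
  by rewrite -[1 in X in _ --> X]cos0; exact: (cvg_comp (fun n => pi *+ 2 / n%:R) (@cos R) h0 (@continuous_cos R 0)).
by rewrite -[0 in X in _ --> X](sin0 R); exact: (cvg_comp (fun n => pi *+ 2 / n%:R) (@sin R) h0 (@continuous_sin R 0)).
Unshelve. all: by end_near.
Qed.

(** Compactness of the segment [[- B, B]], applied to the real and to the imaginary parts, gives
    cluster points; along an ultrafilter these are limits. *)
Lemma ultra_ccvg (U : set_system nat) (u : nat -> C) (B : R) :
  UltraFilter U -> (forall n, cmod (u n) <= B) ->
  exists2 l, ccvg U u l & cmod l <= B.
Proof.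
move=> UU uB.
have real_lim (v : nat -> R) : (forall n, `|v n| <= B) ->
    exists x : R, v n @[n --> U] --> x.
  move=> vB.
  have vF : (v @ U) `[- B, B]%classic.
    apply: (@filterS _ U _ setT) filterT => n _ /=; rewrite in_itv /= -ler_norml; exact: vB.
  have [x [_ cx]] := segment_compact (fmap_proper_filter v ultra_proper) vF.
  exists x; apply/cvgrPdist_lt => e e0.
  (* If the values close to [x] were not in the ultrafilter, the distant ones would be, and [x]
     could not be a cluster point. *)
  have [//|hn] := in_ultra_setVsetC [set n | `|x - v n| < e] UU.
  have hn' : (v @ U) [set y | e <= `|x - y|].
    by apply: (@filterS _ U _ _ _ _ hn) => n /= /negP; rewrite -leNgt.
  have [y [/= ey]] := cx _ _ hn' (nbhsx_ballx x e e0).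
  by rewrite /ball/= ltNge ey.
have [x hx] := real_lim _ (fun n => le_trans (Re_le_cmod (u n)) (uB n)).
have [y hy] := real_lim _ (fun n => le_trans (Im_le_cmod (u n)) (uB n)).
have ul : ccvg U u (x +i* y)%C by apply: ccvg_ReIm.
exists (x +i* y)%C => //.
by apply: (ccvg_le_bound ul); apply: nearW.
Qed.

End RootsOfUnity.

(** * A Cauchy formula for means over roots of unity *)

Section DiscreteCauchy.
Variable R : realType.
Local Notation C := R[i].
Local Notation cmod := (@cmod R).

Section Mean.
Variables (g g' : C -> C) (rho e d : R) (N : nat) (om w : C).
Hypotheses (rho0 : 0 < rho) (e0 : 0 < e) (d0 : 0 < d).
Hypothesis gd : forall p q, cmod p <= rho -> cmod q <= rho -> cmod (q - p) < d ->
  cmod (g q - g p - g' p * (q - p)) <= e * cmod (q - p).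
Hypotheses (N0 : (0 < N)%N) (om1 : cmod om = 1) (omN : om ^+ N = 1) (om_neq1 : om != 1).
Hypotheses (omd : rho * cmod (om - 1) < d) (wrho : cmod w < rho).

Variable zeta : nat -> C.
Hypothesis zetaE : forall k, zeta k = rho%:C%C * om ^+ k.
(** The circle of nodes contracted towards [w]: constant [w] for [l = 0], the nodes themselves for
    [l = 1]. *)
Let p (l : R) k : C := w + l%:C%C * (zeta k - w).

Let cmod_zeta k : cmod (zeta k) = rho.
Proof. by rewrite zetaE cmodM cmodX om1 expr1n mulr1 cmod_pos_real// ltW. Qed.

Let zeta_neq k : zeta k - w != 0.
Proof.
by rewrite subr_eq0; apply/eqP => zw; move: wrho; rewrite -zw cmod_zeta ltxx.
Qed.

Let cmod_p l k : 0 <= l <= 1 -> cmod (p l k) <= rho.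
Proof.
move=> /andP[l0 l1].
have -> : p l k = (1 - l)%:C%C * w + l%:C%C * zeta k.
  by rewrite /p rmorphB rmorph1; ring.
apply: (le_trans (cmodD _ _)); rewrite !cmodM cmod_zeta !cmod_pos_real ?subr_ge0//.
by move: wrho l0 l1; nra.
Qed.

Let telescope (G : C -> C) : \sum_(k < N) (G (zeta k.+1) - G (zeta k)) = 0.
Proof.
rewrite -(big_mkord xpredT (fun k => G (zeta k.+1) - G (zeta k))).
by rewrite telescope_sumr// !zetaE omN expr0 subrr.
Qed.

Let Sd l := \sum_(k < N) g' (p l k) * zeta k.

(** The side from [p l k] to [p l k.+1] is [l (om - 1)] times [zeta k]. After multiplication by
    [l (om - 1)] the sum thus integrates [g'] along a closed polygon, where the increments of [g]
    cancel and only first-order remainders are left. *)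
Let Sd_bound l : 0 <= l <= 1 -> cmod (Sd l) <= N%:R * (e * rho).
Proof.
move=> l01; have [l0 l1] := andP l01.
(* Division by [l] is impossible here, but all points coincide with [w] and the powers of [om] sum
   to 0. *)
have [->|l_neq0] := eqVneq l 0.
  suff -> : Sd 0 = 0 by rewrite cmod0; apply: mulr_ge0 => //; apply: mulr_ge0; exact: ltW.
  rewrite /Sd /p rmorph0; under eq_bigr do rewrite mul0r addr0 zetaE.
  rewrite -mulr_sumr -mulr_sumr; have := subrX1 om N.
  rewrite omN subrr => /esym/eqP; rewrite mulf_eq0 subr_eq0 (negbTE om_neq1) /=.
  by move=> /eqP ->; rewrite !mulr0.
have lp : 0 < l by rewrite lt_def l_neq0.
have om10 : 0 < cmod (om - 1) by rewrite cmod_gt0 subr_eq0.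
have step k : p l k.+1 - p l k = l%:C%C * (om - 1) * zeta k.
  by rewrite /p !zetaE exprS; ring.
have cstep k : cmod (p l k.+1 - p l k) = l * cmod (om - 1) * rho.
  by rewrite step 2!cmodM cmod_zeta cmod_pos_real.
rewrite -(ler_pM2l (mulr_gt0 lp om10)) -[X in X * _ <= _](_ : cmod (l%:C%C * (om - 1)) = _); last first.
  by rewrite cmodM cmod_pos_real.
rewrite -cmodM.
have -> : l%:C%C * (om - 1) * Sd l =
  - \sum_(k < N) (g (p l k.+1) - g (p l k) - g' (p l k) * (p l k.+1 - p l k)).
  rewrite sumrB (telescope (fun z => g (w + l%:C%C * (z - w)))) sub0r opprK mulr_sumr.
  by apply: eq_bigr => k _; rewrite step; ring.
rewrite cmodN; apply: (le_trans (cmod_sum _ _ _)).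
apply: (@le_trans _ _ (\sum_(k < N) e * (l * cmod (om - 1) * rho))).
  apply: ler_sum => k _; rewrite -(cstep k); apply: gd; rewrite ?cmod_p//.
  rewrite cstep; apply: le_lt_trans omd; rewrite mulrC; apply: ler_wpM2l; first exact: ltW.
  by rewrite ler_piMl.
by rewrite sumr_const card_ord -mulr_natl; rewrite le_eqVlt; apply/orP; left; apply/eqP; ring.
Qed.

(** The Cauchy kernel: on a circle centered at 0 the differential of [zeta] is proportional to
    [zeta]. *)
Let v k := zeta k / (zeta k - w).
Let T l := \sum_(k < N) g (p l k) * v k.

(** The kernel cancels the velocity [zeta k - w] of [p l k], so the first-order part is exactly
    [s * Sd l]. It accounts for one half of the bound, the remainders for the other. *)
Let T_step l s : 0 <= l -> 0 <= s -> l + s <= 1 -> s * (2 * rho) < d ->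
  cmod (T (l + s) - T l) <= s * (N%:R * (2 * e * rho)).
Proof.
move=> l0 s0 ls sd.
have l01 : 0 <= l <= 1 by rewrite l0 /=; lra.
have step k : p (l + s) k - p l k = s%:C%C * (zeta k - w).
  by rewrite /p rmorphD; ring.
have -> : T (l + s) - T l = s%:C%C * Sd l +
  \sum_(k < N) (g (p (l + s) k) - g (p l k) - g' (p l k) * (p (l + s) k - p l k)) * v k.
  rewrite /T /Sd mulr_sumr -sumrB -big_split /=; apply: eq_bigr => k _.
  rewrite step /v; field; exact: zeta_neq.
apply: (le_trans (cmodD _ _)).
have -> : s * (N%:R * (2 * e * rho)) = s * (N%:R * (e * rho)) + N%:R * (e * s * rho) by ring.
rewrite lerD//.
  by rewrite cmodM cmod_pos_real// ler_wpM2l// Sd_bound.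
apply: (le_trans (cmod_sum _ _ _)).
rewrite mulr_natl -[in leRHS](card_ord N) -sumr_const; apply: ler_sum => k _.
have cstep : cmod (p (l + s) k - p l k) = s * cmod (zeta k - w).
  by rewrite step cmodM cmod_pos_real.
have zw0 : 0 < cmod (zeta k - w) by rewrite cmod_gt0.
have h : cmod (g (p (l + s) k) - g (p l k) - g' (p l k) * (p (l + s) k - p l k)) <=
    e * (s * cmod (zeta k - w)).
  rewrite -cstep; apply: gd; rewrite ?cmod_p//; first by rewrite ls addr_ge0.
  rewrite cstep; apply: le_lt_trans sd; rewrite ler_wpM2l//.
  by rewrite (le_trans (cmodB _ _))// cmod_zeta mulr_natl mulr2n lerD2l ltW.
rewrite cmodM /v cmodM cmodV cmod_zeta.
apply: (le_trans (ler_wpM2r _ h)); first by rewrite mulr_ge0 ?invr_ge0// ltW.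
rewrite [leLHS](_ : _ = e * s * rho)//; field; exact: lt0r_neq0.
Qed.

(* [T l] has derivative [Sd l], a Riemann sum along a closed curve, which
   telescopes up to [e]; hence [T 1] (the Cauchy kernel mean) and [T 0] (the
   value at [w]) almost agree.  No integral is needed. *)
Lemma cauchy_mean_bound :
  cmod (\sum_(k < N) (g (zeta k) - g w) * (zeta k / (zeta k - w))) <= N%:R * (2 * e * rho).
Proof.
have -> : \sum_(k < N) (g (zeta k) - g w) * (zeta k / (zeta k - w)) = T 1 - T 0.
  rewrite /T -sumrB; apply: eq_bigr => k _; rewrite /p rmorph1 rmorph0 mul1r mul0r addr0.
  by rewrite [w + (_ - w)]addrC subrK /v; ring.
(* Nodes are at distance less than [2 * rho] from [w]; with [m] steps from [l = 0] to [l = 1], each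
   step moves every point by less than [d]. *)
have [m m0 md] : exists2 m : nat, (0 < m)%N & m%:R^-1 * (2 * rho) < d.
  exists (Num.bound (2 * rho / d)).+1 => //.
  rewrite mulrC ltr_pdivrMr ?ltr0n// [ltRHS]mulrC -ltr_pdivrMr//.
  have x0 : 0 <= 2 * rho / d by apply: divr_ge0; [apply: mulr_ge0|]; rewrite // ltW.
  by apply: (lt_trans (archi_boundP x0)); rewrite ltr_nat.
have mR : 0 < m%:R :> R by rewrite ltr0n.
set s : R := m%:R^-1 in md.
have s0 : 0 < s by rewrite invr_gt0.
have msE : m%:R * s = 1 by rewrite mulfV// gt_eqF.
have step i : (i <= m)%N ->
    cmod (T (i%:R * s) - T 0) <= i%:R * s * (N%:R * (2 * e * rho)).
  elim: i => [|i IH] im; first by rewrite !mul0r subrr cmod0.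
  have -> : i.+1%:R * s = i%:R * s + s by rewrite -natr1; ring.
  apply: (le_trans (cmod_dist3 _ (T (i%:R * s)) _)).
  have h : i%:R * s + s <= 1.
    by rewrite -[X in _ + X]mul1r -mulrDl natr1 -[leRHS]msE ler_wpM2r ?(ltW s0)// ler_nat.
  rewrite mulrDl addrC lerD ?IH ?(ltnW im)//.
  by apply: T_step => //; [rewrite mulr_ge0// ltW|exact: ltW].
by have := step m (leqnn m); rewrite msE mul1r.
Qed.

(** All nodes have the same [N]-th power, so each kernel times [1 - (w / rho) ^ N] is the finite
    geometric sum of the [(w / zeta k) ^ j]. Summation over [k] kills every exponent strictly
    between 0 and [N]. *)
Lemma unity_kernel_sum : (forall j, (0 < j < N)%N -> om ^+ j != 1) ->
  (\sum_(k < N) zeta k / (zeta k - w)) * (1 - (w / rho%:C%C) ^+ N) = N%:R.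
Proof.
move=> prim.
have r0 : rho%:C%C != 0 :> C by rewrite -cmod_eq0 cmod_pos_real ?gt_eqF// ltW.
have om0 : om != 0 by rewrite -cmod_eq0 om1 oner_eq0.
have z0 k : zeta k != 0 by rewrite zetaE mulf_neq0// expf_neq0.
have term (k : 'I_N) : zeta k / (zeta k - w) * (1 - (w / rho%:C%C) ^+ N) =
   \sum_(j < N) (w / zeta k) ^+ j.
  have -> : (w / rho%:C%C) ^+ N = (w / zeta k) ^+ N.
    rewrite zetaE invfM mulrA [RHS]exprMn -exprVn exprAC exprVn omN.
    by rewrite invr1 expr1n mulr1.
  have := subrX1 (w / zeta k) N => h.
  rewrite -[1 - _]opprB h; field.
  by rewrite zeta_neq z0.
rewrite mulr_suml; under eq_bigr do rewrite term.
rewrite exchange_big /= -(prednK N0) big_ord_recl /= [X in _ + X]big1 => [|j _].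
  under eq_bigr do rewrite expr0.
  by rewrite sumr_const card_ord addr0.
have jN : (0 < bump 0 j < N)%N.
  by rewrite /bump leq0n add1n /= -[in ltnRHS](prednK N0) ltnS ltn_ord.
move: (bump 0 j) jN => i iN.
under eq_bigr do rewrite zetaE invfM mulrA exprMn -exprVn exprAC.
rewrite -mulr_sumr (prednK N0); apply/eqP; rewrite mulf_eq0; apply/orP; right.
have xN : (om^-1 ^+ i) ^+ N = 1 by rewrite exprAC exprVn omN invr1 expr1n.
have := subrX1 (om^-1 ^+ i) N.
rewrite xN subrr => /esym/eqP.
by rewrite mulf_eq0 subr_eq0 {1}exprVn invr_eq1 (negbTE (prim _ iN)).
Qed.
End Mean.
End DiscreteCauchy.

(** * Taylor series of a uniformly differentiable function on a disc *)

Section Taylor.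
Variable R : realType.
Local Notation C := R[i].
Local Notation cmod := (@cmod R).

(** One modulus [d] for the whole closed disc: the means have unboundedly many nodes, all controlled
    by the same [e]. *)
Definition unif_diff (g g' : C -> C) (rho : R) : Prop :=
  forall e : R, 0 < e -> exists2 d : R, 0 < d &
    forall p q, cmod p <= rho -> cmod q <= rho -> cmod (q - p) < d ->
      cmod (g q - g p - g' p * (q - p)) <= e * cmod (q - p).

Lemma mean_bound N (u : nat -> C) (B : R) : 0 <= B -> (forall k, cmod (u k) <= B) ->
  cmod (N%:R^-1 * \sum_(k < N) u k) <= B.
Proof.
move=> B0 uB; rewrite cmodM cmodV cmod_natr.
case: N => [|N]; first by rewrite invr0 mul0r.
rewrite ler_pdivrMl ?ltr0n//; apply: (le_trans (cmod_sum _ _ _)).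
rewrite mulr_natl -[in leRHS](card_ord N.+1) -sumr_const; exact: ler_sum.
Qed.

Section Circle.
Variables (g g' : C -> C) (rho M : R).
Hypotheses (rho0 : 0 < rho) (gd : unif_diff g g' rho).
Hypothesis gM : forall p, cmod p <= rho -> cmod (g p) <= M.

Let M0 : 0 <= M.
Proof. by apply: (le_trans (cmod_ge0 (g 0))); apply: gM; rewrite cmod0 ltW. Qed.

Definition circle_pt N k : C := rho%:C%C * unity R N ^+ k.

Let cmod_circle N k : cmod (circle_pt N k) = rho.
Proof. by rewrite /circle_pt cmodM cmodX cmod_cis expr1n mulr1 cmod_pos_real// ltW. Qed.

Let kernel w N k : C := circle_pt N k / (circle_pt N k - w).

Let kernel_bound w N k : cmod w < rho ->
  cmod (kernel w N k) <= (1 - rho^-1 * cmod w)^-1.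
Proof.
move=> wr; rewrite /kernel cmodM cmodV cmod_circle.
have h : rho - cmod w <= cmod (circle_pt N k - w).
  rewrite lerBlDr -{1}(cmod_circle N k) -{1}(subrK w (circle_pt N k)).
  exact: cmodD.
have r0 : 0 < rho - cmod w by rewrite subr_gt0.
have -> : (1 - rho^-1 * cmod w)^-1 = rho / (rho - cmod w).
  have : 1 - rho^-1 * cmod w != 0.
    by rewrite subr_eq0 eq_sym lt_eqF// mulrC ltr_pdivrMr// mul1r.
  move=> h0; field; rewrite (gt_eqF r0) /=.
  by rewrite gt_eqF//= mulf_neq0.
by rewrite ler_wpM2l ?(ltW rho0)// lef_pV2 ?posrE// (lt_le_trans r0).
Qed.

Let q01 w : cmod w < rho -> 0 <= rho^-1 * cmod w < 1.
Proof.
move=> wr; apply/andP; split; first by rewrite mulr_ge0// invr_ge0 ltW.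
by rewrite mulrC ltr_pdivrMr// mul1r.
Qed.

Let A w N := N%:R^-1 * \sum_(k < N) g (circle_pt N k) * kernel w N k.

(** [A w N - g w] splits into the mean of [g - g w] against the kernel, controlled by
    [cauchy_mean_bound], and [g w * (S - 1)]. The mean [S] of the kernel satisfies
    [S - 1 = S (w / rho) ^ N], which tends to 0. *)
Let A_cvg w : cmod w < rho -> ccvg \oo (A w) (g w).
Proof.
move=> wr e e0.
have [q0 q1] := andP (q01 wr).
have r1 : 0 < 2 * rho + 1 by rewrite addr_gt0// mulr_gt0.
have e1 : 0 < e / 2 / (2 * rho + 1) by rewrite !divr_gt0.
have [d d0 gde] := gd e1.
have c1 : \forall N \near \oo, cmod (unity R N - 1) < d / rho.
  by apply: unity_cvg1; rewrite divr_gt0.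
have c2 : \forall N \near \oo, M / (1 - rho^-1 * cmod w) * (rho^-1 * cmod w) ^+ N < e / 2.
  have := cvg_geometric0 (M / (1 - rho^-1 * cmod w)) (q01 wr).
  move=> /cvgrPdist_lt /(_ (e / 2)) h; near=> N.
  apply: (le_lt_trans (ler_norm _)); rewrite -normrN -sub0r; near: N; apply: h.
  by rewrite divr_gt0.
near=> N.
have N1 : (1 < N)%N by near: N; exact: nbhs_infty_gt.
have N0 : (0 < N)%N by exact: ltnW.
have NR : N%:R != 0 :> C by rewrite pnatr_eq0 -lt0n.
have om_prim j : (0 < j < N)%N -> unity R N ^+ j != 1 by exact: unity_prim.
have om1 : unity R N != 1 by rewrite -[unity R N]expr1 om_prim.
have omd : rho * cmod (unity R N - 1) < d.
  by rewrite mulrC -ltr_pdivlMr//; near: N; exact: c1.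
have zE k : circle_pt N k = rho%:C%C * unity R N ^+ k by [].
have b1 := cauchy_mean_bound rho0 e1 d0 gde (cmod_cis _) (unity_expr _ N0) om1 omd wr zE.
have b2 := unity_kernel_sum rho0 N0 (cmod_cis _) (unity_expr _ N0) wr zE om_prim.
set S := N%:R^-1 * \sum_(k < N) kernel w N k.
have hS : cmod S <= (1 - rho^-1 * cmod w)^-1.
  apply: mean_bound => [|k]; first by rewrite invr_ge0 subr_ge0 ltW.
  exact: kernel_bound.
have SE : S - 1 = S * (w / rho%:C%C) ^+ N.
  apply/eqP; rewrite subr_eq addrC -subr_eq -[X in X - _]mulr1 -mulrBr.
  by rewrite /S -mulrA b2 mulVf.
have -> : A w N - g w =
  N%:R^-1 * (\sum_(k < N) (g (circle_pt N k) - g w) * kernel w N k) + g w * (S - 1).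
  rewrite /A /S mulrBr mulr1 addrA; congr (_ - _).
  under [in RHS]eq_bigr do rewrite mulrBl.
  by rewrite sumrB -mulr_sumr; ring.
apply: (le_lt_trans (cmodD _ _)); rewrite [ltRHS](splitr e); apply: ler_ltD.
  rewrite cmodM cmodV cmod_natr ler_pdivrMl ?ltr0n//; apply: (le_trans b1).
  rewrite ler_wpM2l// [leLHS](_ : _ = e / 2 * (2 * rho / (2 * rho + 1))); last by ring.
  apply: ler_piMr; first by rewrite divr_ge0// ltW.
  by rewrite ler_pdivrMr// mul1r lerDl.
apply: (@le_lt_trans _ _ (M / (1 - rho^-1 * cmod w) * (rho^-1 * cmod w) ^+ N)); last first.
  by near: N; exact: c2.
rewrite SE [cmod (g w * _)]cmodM [cmod (S * _)]cmodM cmodX [cmod (w / _)]cmodM cmodV cmod_pos_real ?(ltW rho0)// mulrA [cmod w / _]mulrC.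
by rewrite ler_wpM2r ?exprn_ge0// ler_pM// gM// ltW.
Unshelve. all: by end_near.
Qed.

Let mean j N := N%:R^-1 * \sum_(k < N) g (circle_pt N k) * (circle_pt N k)^-1 ^+ j.

Let mean_le j N : cmod (mean j N) <= M * rho^-1 ^+ j.
Proof.
rewrite /mean; apply: (@mean_bound N (fun k => g (circle_pt N k) * (circle_pt N k)^-1 ^+ j)) => [|k]; first by rewrite mulr_ge0// exprn_ge0// invr_ge0 ltW.
rewrite cmodM cmodX cmodV cmod_circle ler_wpM2r ?exprn_ge0 ?invr_ge0 ?(ltW rho0)//.
by rewrite gM// cmod_circle.
Qed.

(** The kernel is the geometric sum of the first [n] powers of [w / zeta], with exact remainder the
    kernel times [(w / zeta) ^ n]; hence a bound that does not depend on [N]. *)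
Let A_mean w n N : cmod w < rho ->
  cmod (A w N - \sum_(j < n) mean j N * w ^+ j) <=
    M * (rho^-1 * cmod w) ^+ n / (1 - rho^-1 * cmod w).
Proof.
move=> wr; have [q0 q1] := andP (q01 wr).
have r0 : rho%:C%C != 0 :> C by rewrite -cmod_eq0 cmod_pos_real ?gt_eqF// ltW.
have z0 k : circle_pt N k != 0 by rewrite -cmod_eq0 cmod_circle gt_eqF.
have zw k : circle_pt N k - w != 0.
  by rewrite subr_eq0; apply/eqP => zw; move: wr; rewrite -zw cmod_circle ltxx.
have -> : A w N - \sum_(j < n) mean j N * w ^+ j =
  N%:R^-1 * \sum_(k < N) g (circle_pt N k) * ((w / circle_pt N k) ^+ n * kernel w N k).
  have -> : \sum_(j < n) mean j N * w ^+ j =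
     N%:R^-1 * \sum_(k < N) g (circle_pt N k) * (\sum_(j < n) (w / circle_pt N k) ^+ j).
    under [in RHS]eq_bigr do rewrite mulr_sumr.
    rewrite exchange_big mulr_sumr; apply: eq_bigr => j _.
    rewrite /mean -mulrA mulr_suml; congr (_ * _); apply: eq_bigr => k _.
    by rewrite exprMn; ring.
  rewrite /A -mulrBr -sumrB; congr (_ * _); apply: eq_bigr => k _.
  rewrite -mulrBr; congr (_ * _); apply/eqP; rewrite subr_eq addrC -subr_eq; apply/eqP.
  have h := subrX1 (w / circle_pt N k) n.
  have -> : kernel w N k - (w / circle_pt N k) ^+ n * kernel w N k =
    - ((w / circle_pt N k) ^+ n - 1) * kernel w N k by ring.
  by rewrite h /kernel; field; rewrite zw z0.
apply: (@mean_bound N (fun k => g (circle_pt N k) * ((w / circle_pt N k) ^+ n * kernel w N k))) => [|k].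
  by rewrite !mulr_ge0 ?exprn_ge0 ?invr_ge0// subr_ge0 ltW.
rewrite [cmod (g _ * _)]cmodM [cmod (_ ^+ n * _)]cmodM cmodX [cmod (w / _)]cmodM cmodV cmod_circle.
rewrite [cmod w / _]mulrC -mulrA; apply: ler_pM => //.
- by apply: mulr_ge0 => //; rewrite exprn_ge0.
- by apply: gM; rewrite cmod_circle.
- by apply: ler_wpM2l; [rewrite exprn_ge0|exact: kernel_bound].
Qed.

(* The coefficients are ultrafilter limits of the means of [g z * z ^- j], so the
   convergence of these Riemann sums need not be proved. *)
Lemma taylor : exists2 c : nat -> C, (forall j, cmod (c j) <= M * rho^-1 ^+ j) &
  forall w, cmod w < rho -> forall n,
    cmod (g w - psum c w n) <= M * (rho^-1 * cmod w) ^+ n / (1 - rho^-1 * cmod w).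
Proof.
have [U [UU oU]] := ultraFilterLemma eventually_filter.
have /choice[c hc] : forall j, exists l, ccvg U (mean j) l /\ cmod l <= M * rho^-1 ^+ j.
  by move=> j; have [l h1 h2] := ultra_ccvg UU (mean_le j); exists l.
exists c => [j|w wr n]; first by have [] := hc j.
have c1 : ccvg U (A w) (g w) by move=> e e0; apply: oU; exact: A_cvg.
have c2 : ccvg U (fun N => \sum_(j < n) mean j N * w ^+ j) (psum c w n).
  apply: (@ccvg_sum R U _ (fun j N => mean j N * w ^+ j) (fun j => c j * w ^+ j)) => j.
  by apply: ccvgMr; have [] := hc j.
apply: (ccvg_le_bound (ccvgB c1 c2)); apply: nearW => N; exact: A_mean.
Qed.

End Circle.
End Taylor.

(** * Expansion in powers of Delta with real coefficients *)

Section SphericalExpansion.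
Variable R : realType.
Local Notation C := R[i].
Local Notation cmod := (@cmod R).
Local Notation Re := (@complex.Re R).
Local Notation Im := (@complex.Im R).

Section HermiteStep.
Variable be : R.
Hypothesis be0 : 0 < be.

Let kap : C := (0 +i* (2 * be))%C.

Definition slope (c : nat -> C) : R := Im (c 0%N) / be.

(* With [z = z0 + h], [z0 = al + i be] and [kap = 2 i be], the polynomial Delta is
   [h (h + kap)], and [c] is [c 0 + slope c * h + Delta * hermite_step c] as power
   series in [h].  The slope is real, and [c 0 + slope c * h] is a real polynomial
   in [z]. *)
Fixpoint hermite_step (c : nat -> C) (n : nat) : C :=
  if n is n'.+1 then (c n.+1 - hermite_step c n') / kap
  else (c 1%N - (slope c)%:C%C) / kap.

Let kap_neq0 : kap != 0.
Proof. by rewrite eq_complex /= eqxx /= mulf_neq0 ?pnatr_eq0 ?gt_eqF. Qed.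

Let cmod_kap : cmod kap = 2 * be.
Proof.
by rewrite cmodE /= expr0n add0r sqrtr_sqr ger0_norm// mulr_ge0// ltW.
Qed.

(** Since [rho <= be], dividing by [kap] multiplies by at most [1 / (2 rho)], and the 2 compensates
    for the difference of two terms. The ratio [rho^-1] is kept, and only the constant grows, by
    [rho^-1 ^+ 2]. *)
Lemma hermite_step_bound c (rho M : R) : 0 < rho -> rho <= be ->
  (forall j, cmod (c j) <= M * rho^-1 ^+ j) ->
  forall j, cmod (hermite_step c j) <= (M * rho^-1 ^+ 2) * rho^-1 ^+ j.
Proof.
move=> r0 rb cM.
have M0 : 0 <= M by have := le_trans (cmod_ge0 _) (cM 0%N); rewrite expr0 mulr1.
have hb : (2 * be)^-1 <= 2^-1 * rho^-1.
  by rewrite invfM ler_wpM2l ?invr_ge0// lef_pV2.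
have rV : 0 < rho^-1 by rewrite invr_gt0.
have half (x y : C) (B : R) : cmod x <= B * rho^-1 -> cmod y <= B * rho^-1 ->
    cmod ((x - y) / kap) <= B * rho^-1 ^+ 2.
  move=> hx hy; rewrite cmodM cmodV cmod_kap.
  have -> : B * rho^-1 ^+ 2 = (B * rho^-1 + B * rho^-1) * (2^-1 * rho^-1) by field; exact: lt0r_neq0.
  by rewrite ler_pM ?invr_ge0 ?mulr_ge0 ?(ltW be0)// (le_trans (cmodB _ _))// lerD.
elim=> [|j IH] /=.
  rewrite expr0 mulr1; apply: half; first by have := cM 1%N; rewrite expr1.
  rewrite cmod_real /slope normrM normfV (gtr0_norm be0).
  rewrite ler_pM ?invr_ge0 ?(ltW be0)// ?lef_pV2//.
  by apply: (le_trans (Im_le_cmod _)); have := cM 0%N; rewrite expr0 mulr1.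
rewrite [leRHS](_ : _ = (M * rho^-1 ^+ 2 * rho^-1 ^+ j * rho) * rho^-1 ^+ 2); last first.
  by rewrite [rho^-1 ^+ j.+1]exprS; field; exact: lt0r_neq0.
have E : M * rho^-1 ^+ 2 * rho^-1 ^+ j * rho * rho^-1 = M * rho^-1 ^+ 2 * rho^-1 ^+ j.
  by rewrite mulfK// gt_eqF.
apply: half; rewrite E//.
by rewrite -mulrA -exprD; exact: cM.
Qed.

(** At finite rank the division is exact up to a single boundary term, which vanishes in the
    limit. *)
Lemma hermite_psum c h n : psum c h n.+2 =
  c 0%N + (slope c)%:C%C * h + h * (h + kap) * psum (hermite_step c) h n.+1
    - hermite_step c n * h ^+ n.+2.
Proof.
elim: n => [|n IH].
  rewrite !psumS /psum !big_ord0 /= expr0 expr1; field.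
  exact: kap_neq0.
rewrite psumS IH [psum _ h n.+2]psumS /= [h ^+ n.+3]exprS [h ^+ n.+2]exprS; field.
exact: kap_neq0.
Qed.

Lemma hermite_pser c (rho M : R) h : 0 < rho -> rho <= be ->
  (forall j, cmod (c j) <= M * rho^-1 ^+ j) -> rho^-1 * cmod h < 1 ->
  pser c h = c 0%N + (slope c)%:C%C * h + h * (h + kap) * pser (hermite_step c) h.
Proof.
move=> r0 rb cM hr.
have rV : 0 <= rho^-1 by rewrite invr_ge0 ltW.
have dM := hermite_step_bound r0 rb cM.
have c1 := pser_cvg rV cM hr.
have c2 := pser_cvg rV dM hr.
have h01 : 0 <= rho^-1 * cmod h < 1 by rewrite hr andbT mulr_ge0.
have shift (u : nat -> C) l : ccvg \oo u l -> ccvg \oo (fun n => u n.+1) l.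
  by move=> ul e e0; have [N _ hN] := ul _ e0; exists N => // n /= Nn; apply: hN => /=; exact: leqW.
have c3 : ccvg \oo (fun n => hermite_step c n * h ^+ n.+2) 0.
  apply: (@ccvg_le _ _ _ (fun n => (M * rho^-1 ^+ 2 * cmod h ^+ 2) * (rho^-1 * cmod h) ^+ n)).
    move=> n; rewrite subr0 cmodM cmodX -[n.+2]addn2 exprD exprMn.
    apply: (le_trans (ler_wpM2r _ (dM n))); first by rewrite mulr_ge0 ?exprn_ge0.
    by rewrite le_eqVlt; apply/orP; left; apply/eqP; ring.
  exact: cvg_geometric0.
have c4 := ccvgB (ccvgMr (h * (h + kap)) (shift _ _ c2)) c3.
have c5 : ccvg \oo (fun n => c 0%N + (slope c)%:C%C * h) (c 0%N + (slope c)%:C%C * h).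
  by move=> e e0; apply: nearW => n; rewrite subrr cmod0.
have c6 := ccvgD c5 (c4 _ _).
apply: (@ccvg_uniq _ \oo _ _ _ _ (shift _ _ (shift _ _ c1))).
move=> e e0; have [N _ hN] := c6 _ _ _ _ e0; exists N => // n /= /hN /=.
rewrite hermite_psum subr0 => he; apply: le_lt_trans he.
by rewrite le_eqVlt; apply/orP; left; apply/eqP; congr cmod; ring.
Qed.

Definition hermite_coef c m := iter m hermite_step c.

Lemma hermite_coef_bound c (rho M : R) m : 0 < rho -> rho <= be ->
  (forall j, cmod (c j) <= M * rho^-1 ^+ j) ->
  forall j, cmod (hermite_coef c m j) <= (M * (rho^-1 ^+ 2) ^+ m) * rho^-1 ^+ j.
Proof.
move=> r0 rb cM; elim: m => [|m IH] j; first by rewrite expr0 mulr1.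
rewrite /hermite_coef iterS; apply: (le_trans (hermite_step_bound r0 rb IH j)).
by rewrite [_ ^+ m.+1]exprSr [M * (_ * _)]mulrA.
Qed.

Lemma hermite_expansion c (rho M : R) h m : 0 < rho -> rho <= be ->
  (forall j, cmod (c j) <= M * rho^-1 ^+ j) -> rho^-1 * cmod h < 1 ->
  pser c h = \sum_(j < m) (h * (h + kap)) ^+ j *
      (hermite_coef c j 0%N + (slope (hermite_coef c j))%:C%C * h)
    + (h * (h + kap)) ^+ m * pser (hermite_coef c m) h.
Proof.
move=> r0 rb cM hr; elim: m => [|m IH]; first by rewrite big_ord0 expr0 mul1r add0r.
rewrite IH big_ord_recr /= -addrA; congr (_ + _).
rewrite (hermite_pser r0 rb (hermite_coef_bound m r0 rb cM) hr) exprSr.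
by ring.
Qed.

End HermiteStep.

Definition taylor_bound (g : C -> C) (z0 : C) (c : nat -> C) (rho M : R) : Prop :=
  forall h, cmod h < rho -> forall n,
    cmod (g (z0 + h) - psum c h n) <= M * (rho^-1 * cmod h) ^+ n / (1 - rho^-1 * cmod h).

Definition conj_sym (g : C -> C) (z0 : C) (rho : R) : Prop :=
  forall z, cmod (z - z0) < rho -> g (z^*)%C = ((g z)^*)%C.

(** [Delta y] on the complex plane for [y = al + be J], whose trace is [2 al] and whose norm is
    [al ^ 2 + be ^ 2]. *)
Definition sph_poly (al be : R) : C -> C := qpoly (2 * al)%:C%C (al ^+ 2 + be ^+ 2)%:C%C.

(* [a] and [b] are real, so only the point [al + i be] has to be inspected: the
   expansion near the conjugate point follows from [conj_sym]. *)
Definition sph_expansion (g : C -> C) (al be : R) (a b : nat -> R) (K L r : R) : Prop :=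
  [/\ forall m, `|a m| <= K * L ^+ m, forall m, `|b m| <= K * L ^+ m &
   forall z, cmod (sph_poly al be z) < r -> forall m,
     cmod (g z - \sum_(j < m) sph_poly al be z ^+ j * ((a j)%:C%C + z * (b j)%:C%C)) <=
       K * (L * cmod (sph_poly al be z)) ^+ m].

Lemma sph_polyE al be z :
  sph_poly al be z = (z - (al +i* be)%C) * (z - (al -i* be)%C).
Proof.
case: z => x y; apply/eqP; rewrite eq_complex /= /sph_poly /qpoly expr2 /=.
by apply/andP; split; apply/eqP; ring.
Qed.

Lemma sph_poly_conj al be z : sph_poly al be (z^*)%C = ((sph_poly al be z)^*)%C.
Proof.
case: z => x y; apply/eqP; rewrite eq_complex /sph_poly /qpoly !expr2 /=.
by apply/andP; split; apply/eqP; ring.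
Qed.

(** The modulus is the product of the distances to two conjugate roots, one of which must be below
    [s]. A ball for the pseudo-metric is thus covered by two conjugate discs. *)
Lemma near_root al be z (s : R) : 0 < s -> cmod (sph_poly al be z) < s ^+ 2 ->
  cmod (z - (al +i* be)%C) < s \/ cmod ((z^*)%C - (al +i* be)%C) < s.
Proof.
move=> s0; rewrite sph_polyE cmodM.
have -> : cmod (z - (al -i* be)%C) = cmod ((z^*)%C - (al +i* be)%C).
  rewrite -cmod_conj; congr cmod; case: z => x y.
  by apply/eqP; rewrite eq_complex /=; apply/andP; split; apply/eqP; ring.
have [h|h] := ltP (cmod (z - _)) s; first by left.
have [h'|h'] := ltP (cmod ((z^*)%C - _)) s; first by right.
by rewrite ltNge expr2 ler_pM// ltW.
Qed.

Lemma sum_conj al be (a b : nat -> R) z m :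
  (\sum_(j < m) sph_poly al be (z^*)%C ^+ j * ((a j)%:C%C + (z^*)%C * (b j)%:C%C)) =
  ((\sum_(j < m) sph_poly al be z ^+ j * ((a j)%:C%C + z * (b j)%:C%C))^*)%C.
Proof.
rewrite rmorph_sum; apply: eq_bigr => j _.
rewrite rmorphM /= rmorphXn /= -sph_poly_conj; congr (_ * _).
case: z => x y.
by apply/eqP; rewrite eq_complex /=; apply/andP; split; apply/eqP; ring.
Qed.

Lemma sph_expansion_half (g : C -> C) (al be : R) (a b : nat -> R) (K L s : R) :
  0 < s -> conj_sym g (al +i* be)%C s ->
  (forall m, `|a m| <= K * L ^+ m) -> (forall m, `|b m| <= K * L ^+ m) ->
  (forall z, cmod (z - (al +i* be)%C) < s -> forall m,
     cmod (g z - \sum_(j < m) sph_poly al be z ^+ j * ((a j)%:C%C + z * (b j)%:C%C)) <=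
       K * (L * cmod (sph_poly al be z)) ^+ m) ->
  sph_expansion g al be a b K L (s ^+ 2).
Proof.
move=> s0 gs aK bK gz; split => // z zr m.
have [h|h] := near_root s0 zr; first exact: gz.
have := gz _ h m; rewrite sum_conj sph_poly_conj cmod_conj.
have e := gs _ h; rewrite conjcK in e.
by rewrite e -[X in X <= _ -> _]cmod_conj rmorphB /= conjcK.
Qed.

(** [L] and [r] depend on the center and on [rho] only, so one choice serves all coordinates of a
    stem. *)
Lemma sph_expansion_nonreal (al be rho : R) : 0 < be -> 0 < rho ->
  exists L r : R, [/\ 0 < r, 0 <= L, L * r < 1 &
    forall (g : C -> C) (M : R) (c : nat -> C), conj_sym g (al +i* be)%C rho ->
      (forall j, cmod (c j) <= M * rho^-1 ^+ j) ->
      taylor_bound g (al +i* be)%C c rho M ->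
      exists (a b : nat -> R) (K : R), sph_expansion g al be a b K L r].
Proof.
move=> b0 r0; set s := Num.min rho be.
have s0 : 0 < s by rewrite lt_min r0.
have sr : s <= rho by rewrite ge_min lexx.
have sb : s <= be by rewrite ge_min lexx orbT.
set L := s^-1 ^+ 2.
have L0 : 0 <= L by rewrite exprn_ge0// invr_ge0 ltW.
(* [L] is the cost of one division by Delta. Halving [s] gives [L * r = 1 / 4], and later
   [s^-1 * cmod h <= 1 / 2]. *)
exists L, ((s / 2) ^+ 2); split => //.
- by rewrite exprn_gt0// divr_gt0.
- rewrite /L exprMn mulrA -exprMn mulVf ?gt_eqF// expr1n mul1r.
  by rewrite expr2; lra.
move=> g M c gs cM gt.
have M0 : 0 <= M by have := le_trans (cmod_ge0 _) (cM 0%N); rewrite expr0 mulr1.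
have cM' j : cmod (c j) <= M * s^-1 ^+ j.
  apply: (le_trans (cM j)); rewrite ler_wpM2l// lerXn2r ?nnegrE ?invr_ge0 ?(ltW s0) ?(ltW r0)//.
  by rewrite lef_pV2.
(* The sum of three bounds: [M + |al| M / be] for [a], [M / be] for [b], and [2 M] for the
   remainder, where [1 - s^-1 * cmod h] is at least [1 / 2]. *)
set K := 3 * M + (`|al| + 1) * M / be.
(* [a j + z * b j] is the linear remainder of the j-th division, rewritten from [h] to
   [z = al + i be + h]; the imaginary part of its constant term vanishes by the choice of the
   slope. *)
set b := fun j => slope be (hermite_coef be c j).
set a := fun j => Re (hermite_coef be c j 0%N) - al * b j.
have hc0 j : cmod (hermite_coef be c j 0%N) <= M * L ^+ j.
  by have := hermite_coef_bound b0 j s0 sb cM' 0%N; rewrite expr0 mulr1.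
have LX j : 0 <= L ^+ j by exact: exprn_ge0.
have alM : 0 <= `|al| * M / be by rewrite divr_ge0 ?mulr_ge0// ltW.
have Mb : 0 <= M / be by rewrite divr_ge0// ltW.
have KE : K = 3 * M + `|al| * M / be + M / be by rewrite /K; ring.
have bB j : `|b j| <= M / be * L ^+ j.
  rewrite /b /slope normrM normfV (gtr0_norm b0) mulrAC ler_wpM2r ?invr_ge0 ?(ltW b0)//.
  exact: le_trans (Im_le_cmod _) (hc0 j).
have bK j : `|b j| <= K * L ^+ j.
  by apply: (le_trans (bB j)); rewrite ler_wpM2r// KE; lra.
have aK j : `|a j| <= K * L ^+ j.
  apply: (le_trans (ler_normB _ _)); rewrite normrM.
  apply: (le_trans (lerD (le_trans (Re_le_cmod _) (hc0 j)) (ler_wpM2l (normr_ge0 al) (bB j)))).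
  have -> : M * L ^+ j + `|al| * (M / be * L ^+ j) = (M + `|al| * M / be) * L ^+ j by ring.
  by rewrite ler_wpM2r// KE; lra.
exists a, b, K.
apply: sph_expansion_half => //; first by rewrite divr_gt0.
  by move=> z zs; apply: gs; apply: (lt_le_trans zs); lra.
move=> z; set h := z - _ => hs m.
have zE : z = (al +i* be)%C + h by rewrite /h addrC subrK.
have hr : cmod h < rho by apply: (lt_le_trans hs); lra.
have hq : rho^-1 * cmod h < 1 by rewrite mulrC ltr_pdivrMr// mul1r.
have hq' : s^-1 * cmod h <= 2^-1 by rewrite mulrC ler_pdivrMr//; lra.
have hq1 : s^-1 * cmod h < 1 by lra.
have gE : g z = pser c h.
  rewrite zE; have rV : 0 <= rho^-1 by rewrite invr_ge0 ltW.
  apply: (@ccvg_uniq _ \oo _ (psum c h)); last exact: pser_cvg cM hq.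
  apply: (@ccvg_le _ _ _ (fun n => M / (1 - rho^-1 * cmod h) * (rho^-1 * cmod h) ^+ n)).
    by move=> n; rewrite cmodBC mulrAC; exact: gt.
  by apply: cvg_geometric0; rewrite hq andbT mulr_ge0.
have DE : sph_poly al be z = h * (h + (0 +i* (2 * be))%C).
  rewrite sph_polyE -/h; congr (_ * _); rewrite zE; case: (h) => x y.
  by apply/eqP; rewrite eq_complex /=; apply/andP; split; apply/eqP; ring.
rewrite gE (hermite_expansion b0 m s0 sb cM' hq1) -DE.
have -> : \sum_(j < m) sph_poly al be z ^+ j * ((a j)%:C%C + z * (b j)%:C%C) =
  \sum_(j < m) sph_poly al be z ^+ j *
    (hermite_coef be c j 0 + (slope be (hermite_coef be c j))%:C%C * h).
  apply: eq_bigr => j _; congr (_ * _); rewrite /a -/(b j) zE.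
  have : Im (hermite_coef be c j 0%N) = be * b j by rewrite /b /slope mulrC divfK// gt_eqF.
  case: (hermite_coef be c j 0%N) => x y /= ->; case: (h) => u v.
  by apply/eqP; rewrite eq_complex /=; apply/andP; split; apply/eqP; ring.
rewrite addrC addKr cmodM cmodX exprMn.
have hb := pser_bound _ (hermite_coef_bound b0 m s0 sb cM') hq1 (lexx (cmod h)).
apply: (le_trans (ler_wpM2l _ (hb _))); rewrite ?exprn_ge0 ?invr_ge0 ?(ltW s0)//.
have -> : cmod (sph_poly al be z) ^+ m * (M * s^-1 ^+ 2 ^+ m / (1 - s^-1 * cmod h)) =
   M / (1 - s^-1 * cmod h) * (L ^+ m * cmod (sph_poly al be z) ^+ m) by rewrite /L; ring.
apply: ler_wpM2r; first by apply: mulr_ge0; [exact: LX|exact: exprn_ge0].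
rewrite ler_pdivrMr ?subr_gt0// KE.
by move: alM Mb M0 hq'; nra.
Qed.

(** The root is double, Delta is [h ^+ 2], and consecutive Taylor terms are paired. Averaging the
    Taylor sum at [h] with the conjugate of the one at the conjugate of [h] replaces every
    coefficient by its real part without changing the limit. *)
Lemma sph_expansion_real (al rho : R) : 0 < rho ->
  exists L r : R, [/\ 0 < r, 0 <= L, L * r < 1 &
    forall (g : C -> C) (M : R) (c : nat -> C), conj_sym g (al +i* 0)%C rho ->
      (forall j, cmod (c j) <= M * rho^-1 ^+ j) ->
      taylor_bound g (al +i* 0)%C c rho M ->
      exists (a b : nat -> R) (K : R), sph_expansion g al 0 a b K L r].
Proof.
move=> r0; have rV : 0 <= rho^-1 by rewrite invr_ge0 ltW.
set L := rho^-1 ^+ 2.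
have L0 : 0 <= L by rewrite exprn_ge0.
have LX j : 0 <= L ^+ j by exact: exprn_ge0.
exists L, ((rho / 2) ^+ 2); split => //.
- by rewrite exprn_gt0// divr_gt0.
- rewrite /L exprMn mulrA -exprMn mulVf ?gt_eqF// expr1n mul1r.
  by rewrite expr2; lra.
move=> g M c gs cM gt.
have M0 : 0 <= M by have := le_trans (cmod_ge0 _) (cM 0%N); rewrite expr0 mulr1.
set b := fun j => Re (c (2 * j).+1).
set a := fun j => Re (c (2 * j)%N) - al * b j.
set K := 2 * M + (`|al| + 1) * M * rho^-1.
have Mr : 0 <= M * rho^-1 by rewrite mulr_ge0.
have alM : 0 <= `|al| * M * rho^-1 by rewrite !mulr_ge0.
have KE : K = 2 * M + `|al| * M * rho^-1 + M * rho^-1 by rewrite /K; ring.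
have bB j : `|b j| <= M * rho^-1 * L ^+ j.
  apply: (le_trans (Re_le_cmod _)); apply: (le_trans (cM _)).
  by rewrite exprS exprM mulrA.
have bK j : `|b j| <= K * L ^+ j.
  by apply: (le_trans (bB j)); rewrite ler_wpM2r// KE; lra.
have aK j : `|a j| <= K * L ^+ j.
  apply: (le_trans (ler_normB _ _)); rewrite normrM.
  have h0 : `|Re (c (2 * j)%N)| <= M * L ^+ j.
    by apply: (le_trans (Re_le_cmod _)); apply: (le_trans (cM _)); rewrite exprM.
  apply: (le_trans (lerD h0 (ler_wpM2l (normr_ge0 al) (bB j)))).
  have -> : M * L ^+ j + `|al| * (M * rho^-1 * L ^+ j) = (M + `|al| * M * rho^-1) * L ^+ j by ring.
  by rewrite ler_wpM2r// KE; lra.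
exists a, b, K.
apply: sph_expansion_half => //; first by rewrite divr_gt0.
  by move=> z zs; apply: gs; apply: (lt_le_trans zs); lra.
move=> z; set h := z - _ => hs m.
have zE : z = (al +i* 0)%C + h by rewrite /h addrC subrK.
have hr : cmod h < rho by apply: (lt_le_trans hs); lra.
have hq' : rho^-1 * cmod h <= 2^-1 by rewrite mulrC ler_pdivrMr//; lra.
have DE : sph_poly al 0 z = h ^+ 2.
  rewrite sph_polyE expr2 -/h; congr (_ * _); rewrite zE; case: (h) => x y.
  by apply/eqP; rewrite eq_complex /=; apply/andP; split; apply/eqP; ring.
have sE : \sum_(j < m) sph_poly al 0 z ^+ j * ((a j)%:C%C + z * (b j)%:C%C) =
  psum (fun k => (Re (c k))%:C%C) h (2 * m).
  elim: m => [|m IH]; first by rewrite muln0 /psum !big_ord0.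
  rewrite big_ord_recr /= IH mulnS !psumS -addrA; congr (_ + _).
  rewrite DE -exprM exprS /a -/(b m) zE /b.
  have -> : (al +i* 0)%C = al%:C%C by [].
  by rewrite rmorphB rmorphM; ring.
have hc : cmod (h^*)%C < rho by rewrite cmod_conj.
have t1 := gt _ hr (2 * m)%N.
have t2 := gt _ hc (2 * m)%N.
have zE' : (al +i* 0)%C + (h^*)%C = (z^*)%C.
  rewrite zE; case: (h) => x y.
  by apply/eqP; rewrite eq_complex /=; apply/andP; split; apply/eqP; ring.
rewrite zE' gs in t2; last by rewrite -/h.
rewrite -zE in t1.
have pE : psum (fun k => (Re (c k))%:C%C) h (2 * m) =
   2^-1 * (psum c h (2 * m) + ((psum c (h^*)%C (2 * m))^*)%C).
  rewrite /psum rmorph_sum -big_split mulr_sumr /=; apply: eq_bigr => k _.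
  rewrite rmorphM rmorphXn /= conjcK -mulrDl mulrA; congr (_ * _).
  by rewrite ReJ_add mulrC.
rewrite sE pE; move: (g z) (psum c h _) (psum c (h^*)%C _) t1 t2 => A B D t1 t2.
have -> : A - 2^-1 * (B + (D^*)%C) = 2^-1 * ((A - B) + ((A^*)%C - D)^*%C).
  have -> : (((A^*)%C - D)^*)%C = A - (D^*)%C by rewrite raddfB /= conjcK.
  by field.
rewrite cmodM cmodV cmod_natr.
apply: (le_trans (ler_wpM2l _ (cmodD _ _))); first by rewrite invr_ge0.
rewrite cmod_conj in t2 *.
have E : M * (rho^-1 * cmod h) ^+ (2 * m) / (1 - rho^-1 * cmod h) <= 
     2 * M * (L * cmod (sph_poly al 0 z)) ^+ m.
  have -> : L * cmod (sph_poly al 0 z) = (rho^-1 * cmod h) ^+ 2.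
    by rewrite DE cmodX exprMn.
  rewrite -exprM mulrAC; apply: ler_wpM2r; first by rewrite exprn_ge0 ?mulr_ge0.
  rewrite ler_pdivrMr; last by lra.
  by move: M0 hq'; nra.
have E2 : 2 * M * (L * cmod (sph_poly al 0 z)) ^+ m <= K * (L * cmod (sph_poly al 0 z)) ^+ m.
  by rewrite ler_wpM2r ?exprn_ge0 ?mulr_ge0// KE; lra.
by rewrite cmod_conj; move: E E2 t1 t2; lra.
Qed.

End SphericalExpansion.

(** * Coordinates of [A] and their continuity *)

Section FiniteDimension.
Variables (R : realType) (A : normedAltStarAlgType R).

Definition dimA : nat := \dim (fullv : {vspace A}).
Definition basA : dimA.-tuple A := vbasis fullv.
Definition phi (k : 'I_dimA) : A -> R := coord basA k.

HB.instance Definition _ k := GRing.Linear.copy (phi k) (coord basA k).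

Lemma phi_sum x : x = \sum_k phi k x *: basA`_k.
Proof. exact: coord_vbasis (memvf x). Qed.

Lemma phi_comb (u : 'I_dimA -> R) k : phi k (\sum_i u i *: basA`_i) = u k.
Proof. by rewrite /phi coord_sum_free// (basis_free (vbasisP _)). Qed.

Lemma phi_inj (x x' : A) : (forall k : 'I_dimA, phi k x = phi k x') -> x = x'.
Proof. by move=> e; rewrite [x]phi_sum [x']phi_sum; apply: eq_bigr => k _; rewrite e. Qed.

Lemma phiD (k : 'I_dimA) (x x' : A) : phi k (x + x') = phi k x + phi k x'.
Proof. exact: raddfD. Qed.

Lemma phiN (k : 'I_dimA) (x : A) : phi k (- x) = - phi k x.
Proof. exact: raddfN. Qed.

Lemma phiZ (k : 'I_dimA) (a : R) (x : A) : phi k (a *: x) = a * phi k x.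
Proof. exact: linearZ. Qed.

Lemma lipschitz_continuous (V W : normedModType R) (f : V -> W) (K : R) :
  (forall x y, `|f x - f y| <= K * `|x - y|) -> continuous f.
Proof.
move=> fK x; apply/cvgrPdist_lt => e e0.
have K0 : 0 < `|K| + 1 by rewrite ltr_wpDl.
near=> y; apply: (le_lt_trans (fK _ _)).
apply: (@le_lt_trans _ _ ((`|K| + 1) * `|x - y|)).
  by rewrite ler_wpM2r// (le_trans (ler_norm K))// lerDl.
rewrite mulrC -ltr_pdivlMr//; near: y.
by apply: cvgr_dist_lt; [exact: cvg_id|rewrite divr_gt0].
Unshelve. all: by end_near.
Qed.

Let comb (v : 'rV[R]_dimA) : A := \sum_i v ord0 i *: basA`_i.

Let entry_le (v : 'rV[R]_dimA) i : `|v ord0 i| <= `|v|.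
Proof.
have -> : `|v| = mx_norm v by [].
by rewrite mx_normrE; apply/bigmax_geP; right => /=; exists (ord0, i).
Qed.

Let comb_le v : `|comb v| <= (\sum_(i < dimA) `|basA`_i|) * `|v|.
Proof.
apply: (le_trans (ler_norm_sum _ _ _)); rewrite mulr_suml; apply: ler_sum => i _.
by rewrite normrZ mulrC ler_wpM2l.
Qed.

Let combB v w : comb v - comb w = comb (v - w).
Proof. by rewrite /comb -sumrB; apply: eq_bigr => i _; rewrite !mxE scalerBl. Qed.

Let combZ a v : comb (a *: v) = a *: comb v.
Proof. by rewrite /comb scaler_sumr; apply: eq_bigr => i _; rewrite !mxE scalerA. Qed.

(** Equivalence of norms: the norm of [comb v] is continuous and positive on the compact unit sphere
    of row vectors, and the inverse of its minimum bounds the coordinates. *)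
Lemma phi_bounded : exists2 K : R, 0 < K & forall k x, `|phi k x| <= K * `|x|.
Proof.
pose S := [set v : 'rV[R]_dimA | `|v| = 1].
have cS : closed S.
  rewrite (_ : S = (fun v : 'rV[R]_dimA => `|v|) @^-1` [set 1]) //.
  apply: closed_comp; [by move=> v _; exact: norm_continuous|exact: closed_eq].
(* When the sphere is empty, normalization shows that every coordinate vector is 0. *)
have [S0|/set0P/negP/negPn/eqP S0] := pselect (S !=set0); last first.
  exists 1 => // k x.
  suff -> : phi k x = 0 by rewrite normr0 mul1r.
  pose v := \row_k phi k x.
  have [v0|v0] := eqVneq v 0; first by have := congr1 (fun w : 'rV[R]_dimA => w ord0 k) v0; rewrite !mxE.
  have : S (`|v|^-1 *: v) by rewrite /S /= normrZ normfV normr_id mulVf// normr_eq0.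
  by rewrite S0.
have bS : bounded_set S by exists 1; split => // M M1 v /= ->; exact: ltW.
have [w /set_mem wS wmin] : exists2 c, c \in S & forall t, t \in S -> `|comb c| <= `|comb t|.
  apply: compact_EVT_min => //; first exact: bounded_closed_compact.
  apply: continuous_subspaceT.
  apply: (@lipschitz_continuous _ _ _ (\sum_(i < dimA) `|basA`_i|)) => v u.
  by apply: (le_trans (ler_dist_dist _ _)); rewrite combB.
have w0 : 0 < `|comb w|.
  rewrite normr_gt0; apply/eqP => cw.
  have : w = 0.
    apply/rowP => i; rewrite !mxE -(phi_comb (fun i => w ord0 i)) -/(comb w) cw.
    by rewrite raddf0.
  by move=> w0; move: wS; rewrite /S /= w0 normr0 => /eqP; rewrite eq_sym oner_eq0.
exists (`|comb w|^-1); first by rewrite invr_gt0.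
move=> k x; pose v := \row_k phi k x.
have xE : comb v = x by rewrite [RHS]phi_sum /comb; apply: eq_bigr => i _; rewrite mxE.
have -> : phi k x = v ord0 k by rewrite mxE.
apply: (le_trans (entry_le _ _)); rewrite ler_pdivlMl//.
have [->|v0] := eqVneq v 0; first by rewrite normr0 mulr0.
have vp : 0 < `|v| by rewrite normr_gt0.
have : S (`|v|^-1 *: v) by rewrite /S /= normrZ normfV normr_id mulVf// normr_eq0.
move=> /mem_set /wmin; rewrite combZ xE normrZ normfV normr_id mulrC.
by rewrite ler_pdivlMr.
Qed.

Lemma linear_bounded (W : normedModType R) (f : {linear A -> W}) :
  exists2 K : R, 0 < K & forall x, `|f x| <= K * `|x|.
Proof.
have [K K0 hK] := phi_bounded.
exists (K * \sum_(i < dimA) `|f basA`_i| + 1).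
  by rewrite ltr_wpDl// mulr_ge0 ?(ltW K0)// sumr_ge0.
move=> x; rewrite {1}[x]phi_sum linear_sum; apply: (le_trans (ler_norm_sum _ _ _)).
apply: (@le_trans _ _ (K * (\sum_(i < dimA) `|f basA`_i|) * `|x|)); last first.
  by rewrite ler_wpM2r// lerDl.
rewrite mulrAC mulr_sumr; apply: ler_sum => i _.
by rewrite linearZ normrZ ler_wpM2r.
Qed.

Lemma linear_findim_continuous (W : normedModType R) (f : {linear A -> W}) : continuous f.
Proof.
have [K K0 hK] := linear_bounded f.
by apply: (@lipschitz_continuous _ _ _ K) => x y; rewrite -linearB.
Qed.

End FiniteDimension.

(** * Uniform continuity and boundedness on compact sets *)

Section CompactContinuity.
Variables (R : realType) (V W : normedModType R).

(** Continuity at the points of [K] is that of a function on the whole space, so [y] may lie outside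
    [K]. Compactness is used in its near-covering form, along the filter of small positive [d]. *)
Lemma compact_unif_continuous (f : V -> W) (K : set V) : compact K ->
  (forall x, K x -> {for x, continuous f}) ->
  forall e : R, 0 < e -> exists2 d : R, 0 < d &
    forall x y, K x -> `|x - y| < d -> `|f x - f y| < e.
Proof.
move=> /compact_near_coveringP cK fc e e0.
have e20 : 0 < e / 2 by rewrite divr_gt0.
pose P (d : R) x := forall y, `|x - y| < d -> `|f x - f y| < e.
have [|c /= c0 hd] := cK _ (0^'+ : set_system R) P _; last first.
  have [d [d0 dd]] : exists d : R, 0 < d /\ d < c.
    by exists (c / 2); split; [rewrite divr_gt0|rewrite ltr_pdivrMr// ltr_pMr// ltr1n].
  exists d => // x y Kx; apply: (hd d) => //=.
  by rewrite sub0r normrN gtr0_norm.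
move=> x Kx; have /cvgrPdist_lt/(_ _ e20)/nbhs_normP[g /= g0 hg] := fc x Kx.
have g20 : 0 < g / 2 by rewrite divr_gt0.
exists ([set x' | `|x - x'| < g / 2], [set d : R | d < g / 2]).
  split => /=; first by apply/nbhs_normP; exists (g / 2).
  by exists (g / 2) => // d /=; rewrite sub0r normrN => h _; exact: le_lt_trans (ler_norm _) h.
move=> [x' d] /= [hx' hd] y hy.
have h1 := hg _ (lt_trans hx' _ : `|x - x'| < g).
have xy : `|x - y| < g.
  rewrite -(subrK x' x) -addrA [ltRHS]splitr (le_lt_trans (ler_normD _ _))//.
  by rewrite ltrD// (lt_trans hy).
have h2 := hg _ xy.
rewrite -(subrK (f x) (f x')) -addrA [ltRHS]splitr (le_lt_trans (ler_normD _ _))//.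
rewrite ltrD// distrC; apply: h1.
by rewrite ltr_pdivrMr// ltr_pMr// ltr1n.
Qed.

Lemma compact_continuous_bounded (f : V -> W) (K : set V) : compact K ->
  (forall x, K x -> {for x, continuous f}) ->
  exists M : R, forall x, K x -> `|f x| <= M.
Proof.
move=> cK fc.
have [M [_ hM]] : bounded_set (f @` K).
  apply: compact_bounded; apply: continuous_compact => //.
  by apply: continuous_in_subspaceT => x /set_mem Kx; exact: fc.
exists (M + 1) => x Kx; apply: (hM (M + 1)); first by rewrite ltrDl.
by exists x.
Qed.

End CompactContinuity.

(** * The mean value theorem in a given direction *)

Section DirectionalMVT.
Variables (R : realType) (V : normedModType R).

Lemma is_derive_line (W : normedModType R) (u : V -> W) (p v : V) (t : R) :
  derivable u (p + t *: v) v ->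
  is_derive t 1 (fun s : R => u (p + s *: v)) ('D_v u (p + t *: v)).
Proof.
move=> du.
have E : (fun h : R => h^-1 *: (((fun s : R => u (p + s *: v)) \o shift t) (h *: 1) - u (p + t *: v))) =
  (fun h : R => h^-1 *: ((u \o shift (p + t *: v)) (h *: v) - u (p + t *: v))).
  apply/funext => h /=; congr (_ *: (u _ - _)).
  by rewrite scalerDl addrCA /GRing.scale /= mulr1.
by split; [rewrite /derivable E|rewrite /derive E].
Qed.

(** The conditions [|t| <= |s|] and [0 <= s * t] place [t] between 0 and [s] whatever the sign of
    [s]. *)
Lemma directional_mvt (u : V -> R) (p v : V) (s : R) :
  (forall t : R, `|t| <= `|s| -> 0 <= s * t -> derivable u (p + t *: v) v) ->
  exists t : R, [/\ `|t| <= `|s|, 0 <= s * t &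
    u (p + s *: v) - u p = 'D_v u (p + t *: v) * s].
Proof.
move=> du.
have key (a b : R) : a <= b -> (forall t, a <= t <= b -> derivable u (p + t *: v) v) ->
    exists2 t, a <= t <= b &
      u (p + b *: v) - u (p + a *: v) = 'D_v u (p + t *: v) * (b - a).
  move=> ab d.
  have dt t : t \in `[a, b] -> is_derive t 1 (fun s : R => u (p + s *: v)) ('D_v u (p + t *: v)).
    by rewrite in_itv /= => h; apply: is_derive_line; exact: d.
  have cont : {within `[a, b], continuous (fun s : R => u (p + s *: v))}.
    by apply: derivable_within_continuous => t tab; have [] := dt _ tab.
  have dt' x : x \in `]a, b[ -> is_derive x 1 (fun s : R => u (p + s *: v)) ('D_v u (p + x *: v)).
    by move=> xab; apply: dt; exact: subset_itv_oo_cc xab.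
  have [t tab E] := MVT_segment (df := fun t => 'D_v u (p + t *: v)) ab dt' cont.
  by exists t => //; move: tab; rewrite in_itv.
have [s0|s0] := leP 0 s.
  have [|t /andP[t0 ts]] := key 0 s s0.
    by move=> t /andP[t0 ts]; apply: du; rewrite ?mulr_ge0// !ger0_norm.
  rewrite scale0r addr0 subr0 => e.
  by exists t; split; rewrite ?mulr_ge0// !ger0_norm.
have [|t /andP[st t0]] := key s 0 (ltW s0).
  move=> t /andP[st t0]; apply: du; last by rewrite mulr_le0// ltW.
  by rewrite ler0_norm// ltr0_norm// lerN2.
rewrite scale0r addr0 sub0r => e.
exists t; split; last by rewrite -opprB e mulrN opprK.
  by rewrite ler0_norm// ltr0_norm// lerN2.
by rewrite mulr_le0// ltW.
Qed.

End DirectionalMVT.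

(** * From continuous partial derivatives to uniform differentiability *)

Section PartialDerivatives.
Variables (R : realType) (u ux uy : R * R -> R) (a b r : R).
Hypothesis r0 : 0 < r.

Definition box : set (R * R) := [set p | `|p.1 - a| <= r /\ `|p.2 - b| <= r].

Lemma box_compact : compact box.
Proof.
have -> : box = `[a - r, a + r]%classic `*` `[b - r, b + r]%classic.
  apply/seteqP; split=> [p [p1 p2]|p [p1 p2]].
    by split; rewrite /= in_itv /=; move: p1 p2; rewrite !ler_norml; lra.
  by split; move: p1 p2; rewrite /= !in_itv /= !ler_norml; lra.
by apply: compact_setX; exact: segment_compact.
Qed.

Hypothesis du : forall p, box p ->
  is_derive p (1, 0) u (ux p) /\ is_derive p (0, 1) u (uy p).

(** The mean value theorem is applied on the vertical segment from [p] to the corner [(p.1, q.2)],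
    then on the horizontal one to [q]. A box contains this corner, which a disc may not. *)
Lemma box_mvt p q : box p -> box q ->
  exists x y : R * R, [/\ box x /\ box y, `|x - p| <= `|q - p|, `|y - p| <= `|q - p| &
    u q - u p = ux x * (q.1 - p.1) + uy y * (q.2 - p.2)].
Proof.
case: p q => [p1 p2] [q1 q2] [/= bp1 bp2] [/= bq1 bq2].
have between (c d e t : R) : `|c - e| <= r -> `|d - e| <= r ->
    `|t| <= `|d - c| -> 0 <= (d - c) * t -> `|c + t - e| <= r.
  rewrite !ler_norml => /andP[h1 h2] /andP[h3 h4] /andP[h5 h5'] h6.
  have [dc|dc] := leP 0 (d - c).
    have t0 : 0 <= t.
      have [dc0|dc0] := eqVneq (d - c) 0.
        by move: h5 h5'; rewrite dc0 normr0; lra.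
      by move: h6; rewrite pmulr_rge0// lt_def dc0.
    by move: h5 h5'; rewrite ger0_norm// => h5 h5'; apply/andP; split; lra.
  have t0 : t <= 0 by move: h6; rewrite nmulr_rge0.
  by move: h5 h5'; rewrite ltr0_norm// => h5 h5'; apply/andP; split; lra.
have [|t [t1 t2 tE]] := @directional_mvt R _ u (p1, p2) (0, 1) (q2 - p2).
  move=> t t1 t2; apply: ex_derive; apply: (du _).2; split => /=; first by rewrite scaler0 addr0.
  by rewrite /GRing.scale /= mulr1; exact: between t1 t2.
have [|s [s1 s2 sE]] := @directional_mvt R _ u (p1, q2) (1, 0) (q1 - p1).
  move=> s s1 s2; apply: ex_derive; apply: (du _).1; split => /=; last by rewrite scaler0 addr0.
  by rewrite /GRing.scale /= mulr1; exact: between s1 s2.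
have E1 (c d e : R) : (c, d) + e *: ((1, 0) : R * R) = (c + e, d).
  by apply/pair_equal_spec; split; rewrite /= /GRing.scale /= ?mulr1 ?mulr0 ?addr0.
have E2 (c d e : R) : (c, d) + e *: ((0, 1) : R * R) = (c, d + e).
  by apply/pair_equal_spec; split; rewrite /= /GRing.scale /= ?mulr1 ?mulr0 ?addr0.
rewrite !E1 !E2 in sE tE.
have qE (c d : R) : c + (d - c) = d by rewrite addrC subrK.
rewrite !qE in sE tE.
have nE (c d : R) : `|(c, d)| = Num.max `|c| `|d| by [].
have subE (c d e f : R) : (c, d) - (e, f) = (c - e, d - f) by [].
have bx : box (p1 + s, q2) by split => //=; exact: between s1 s2.
have by_ : box (p1, p2 + t) by split => //=; exact: between t1 t2.
exists (p1 + s, q2), (p1, p2 + t); split => //.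
- by rewrite !subE !nE [p1 + s]addrC addrK ge_max !le_max s1 lexx orbT.
- by rewrite !subE !nE [p2 + t]addrC addrK subrr normr0 ge_max !le_max t1 normr_ge0 orbT.
- rewrite /= -(@derive_val _ _ _ _ _ _ _ (du bx).1) -(@derive_val _ _ _ _ _ _ _ (du by_).2).
  by rewrite -sE -tE; ring.
Qed.

Hypothesis cu : forall p, box p -> {for p, continuous ux} /\ {for p, continuous uy}.

(** The partial derivatives at the intermediate points differ from those at [p] by at most [e], by
    uniform continuity on the compact box. *)
Lemma box_unif_diff (e : R) : 0 < e -> exists2 d : R, 0 < d &
  forall p q, box p -> box q -> `|q - p| < d ->
    `|u q - u p - (ux p * (q.1 - p.1) + uy p * (q.2 - p.2))| <=
      e * (`|q.1 - p.1| + `|q.2 - p.2|).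
Proof.
move=> e0.
have [d1 d10 h1] := compact_unif_continuous box_compact (fun p bp => (cu bp).1) e0.
have [d2 d20 h2] := compact_unif_continuous box_compact (fun p bp => (cu bp).2) e0.
exists (Num.min d1 d2); first by rewrite lt_min d10.
move=> p q bp bq; rewrite lt_min => /andP[hd1 hd2].
have [x [y [[bx by_] xp yp ->]]] := box_mvt bp bq.
have -> : ux x * (q.1 - p.1) + uy y * (q.2 - p.2) - (ux p * (q.1 - p.1) + uy p * (q.2 - p.2)) =
   (ux x - ux p) * (q.1 - p.1) + (uy y - uy p) * (q.2 - p.2) by ring.
rewrite (le_trans (ler_normD _ _))// !normrM mulrDr lerD// ler_wpM2r// ltW//.
  by apply: h1 => //; exact: le_lt_trans hd1.
by apply: h2 => //; exact: le_lt_trans hd2.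
Qed.

Lemma box_bounded : exists M : R, forall p, box p -> `|u p| <= M.
Proof.
have [M1 h1] := compact_continuous_bounded box_compact (fun p bp => (cu bp).1).
have [M2 h2] := compact_continuous_bounded box_compact (fun p bp => (cu bp).2).
have b0 : box (a, b) by split; rewrite /= subrr normr0 ltW.
exists (`|u (a, b)| + (M1 * r + M2 * r)) => p bp.
have [x [y [[bx by_] _ _ E]]] := box_mvt b0 bp.
rewrite -(subrK (u (a, b)) (u p)) E addrC (le_trans (ler_normD _ _))// lerD2l.
rewrite (le_trans (ler_normD _ _))// !normrM; case: (bp) => p1 p2.
by rewrite lerD// ler_pM// ?h1 ?h2.
Qed.

End PartialDerivatives.

(** * Directional derivatives: linear maps and quadratic remainders *)

Section LinearDerivative.
Variables (R : realType) (V W W' : normedModType R).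

Lemma is_derive_linear_comp (l : W -> W') (F : V -> W) (z v : V) :
  (forall x y, l (x - y) = l x - l y) -> (forall a x, l (a *: x) = a *: l x) ->
  continuous l -> derivable F z v -> is_derive z v (l \o F) (l ('D_v F z)).
Proof.
move=> lB lZ cl dF.
have h : (fun h : R => h^-1 *: (((l \o F) \o shift z) (h *: v) - (l \o F) z)) @ 0^' --> l ('D_v F z).
  have -> : (fun h : R => h^-1 *: (((l \o F) \o shift z) (h *: v) - (l \o F) z)) =
    l \o (fun h : R => h^-1 *: ((F \o shift z) (h *: v) - F z)).
    by apply/funext => h /=; rewrite lZ lB.
  exact: (cvg_comp _ l dF (cl _)).
split; first by apply/cvg_ex; exists (l ('D_v F z)).
exact: (cvg_lim _ h).
Qed.

Lemma derive_quad (F : V -> W) (z v : V) (L : W) (B d : R) : 0 < d ->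
  (forall h : R, `|h| < d -> `|F (z + h *: v) - F z - h *: L| <= B * `|h| ^+ 2) ->
  is_derive z v F L.
Proof.
move=> d0 hF.
have h : (fun h : R => h^-1 *: ((F \o shift z) (h *: v) - F z)) @ 0^' --> L.
  apply/cvgrPdist_lt => e e0.
  have B0 : 0 < `|B| + 1 by rewrite ltr_wpDl.
  have m0 : 0 < Num.min d (e / (`|B| + 1)) by rewrite lt_min d0 divr_gt0.
  exists (Num.min d (e / (`|B| + 1))) => //= h.
  rewrite /ball_ /= ?sub0r ?normrN lt_min => /andP[hd he] h0.
  have hp : 0 < `|h| by rewrite normr_gt0.
  rewrite distrC -[L](scalerK h0) -scalerBr normrZ normfV mulrC ltr_pdivrMr//.
  rewrite [h *: v + z]addrC; apply: (le_lt_trans (hF h hd)).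
  rewrite expr2 mulrA ltr_pM2r//.
  apply: (@le_lt_trans _ _ ((`|B| + 1) * `|h|)).
    by rewrite ler_wpM2r// (le_trans (ler_norm B))// lerDl.
  by rewrite mulrC -ltr_pdivlMr.
split; first by apply/cvg_ex; exists L.
exact: (cvg_lim _ h).
Qed.

End LinearDerivative.

(** * Holomorphic stems in complex coordinates *)

Section HolomorphicStems.
Variables (R : realType) (A : normedAltStarAlgType R).
Local Notation C := R[i].
Local Notation cmod := (@cmod R).
Local Notation Re := (@complex.Re R).
Local Notation Im := (@complex.Im R).
Local Notation dimA := (dimA A).

(** Stems live on [R * R], which carries the product topology, whereas computations need the field
    [R[i]]; [pt] and [ofpt] translate. *)
Definition pt (z : C) : R * R := (Re z, Im z).
Definition cphi (k : 'I_dimA) (w : A * A) : C := (phi k w.1 +i* phi k w.2)%C.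
Definition coord_fun (F : R * R -> A * A) (k : 'I_dimA) (z : C) : C := cphi k (F (pt z)).

Lemma phi_continuous (k : 'I_dimA) : continuous (phi k : A -> R).
Proof. exact: linear_findim_continuous. Qed.

Lemma normB_pair (V W : normedModType R) (x y : V * W) :
  `|x - y| = Num.max `|x.1 - y.1| `|x.2 - y.2|.
Proof. by []. Qed.

Lemma open_box (D : set (R * R)) (z : R * R) : open D -> D z ->
  exists2 r : R, 0 < r & box z.1 z.2 r `<=` D.
Proof.
move=> oD Dz; have /nbhs_normP[e /= e0 he] := open_nbhs_nbhs (conj oD Dz).
exists (e / 2); first by rewrite divr_gt0.
move=> p [p1 p2]; apply: he => /=; rewrite normB_pair gt_max distrC [`|z.2 - _|]distrC.
have e2 : e / 2 < e by rewrite ltr_pdivrMr// ltr_pMr// ltr1n.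
by apply/andP; split; [exact: le_lt_trans p1 e2|exact: le_lt_trans p2 e2].
Qed.

Lemma dbar0_partial (F : R * R -> A * A) z : dbar F z = 0 ->
  partial_beta F z = (- (partial_alpha F z).2, (partial_alpha F z).1).
Proof.
rewrite /dbar => /eqP; rewrite scaler_eq0 invr_eq0 pnatr_eq0 /= => /eqP.
case: (partial_alpha F z) => a1 a2; case: (partial_beta F z) => b1 b2 [/= h1 h2].
congr (_, _); first by apply/eqP; rewrite -addr_eq0 addrC h2.
by apply/eqP; rewrite eq_sym -subr_eq0 h1.
Qed.

(** The radius comes from a box inside [D], hence is common to all coordinates. The modulus and the
    bound may depend on [k]. *)
Lemma holo_unif_diff (D : set (R * R)) (F : R * R -> A * A) (z0 : C) :
  open D -> class_C1 D F -> (forall z, D z -> dbar F z = 0) -> D (pt z0) ->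
  exists2 rho : R, 0 < rho & (forall h, cmod h <= rho -> D (pt (z0 + h))) /\
    forall k, exists M g',
      unif_diff (fun h => coord_fun F k (z0 + h)) g' rho /\
      forall h, cmod h <= rho -> cmod (coord_fun F k (z0 + h)) <= M.
Proof.
move=> oD CF dF Dz; have [r r0 bD] := open_box oD Dz.
have hbox h : cmod h <= r -> box (pt z0).1 (pt z0).2 r (pt (z0 + h)).
  move=> hr; split; rewrite /= raddfD /= addrAC subrr add0r.
    exact: le_trans (Re_le_cmod _) hr.
  exact: le_trans (Im_le_cmod _) hr.
exists r => //; split=> [h hr|k]; first exact: bD (hbox _ hr).
pose l1 (w : A * A) : R := phi k w.1; pose l2 (w : A * A) : R := phi k w.2.
have l1B x y : l1 (x - y) = l1 x - l1 y by rewrite /l1 raddfB.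
have l2B x y : l2 (x - y) = l2 x - l2 y by rewrite /l2 raddfB.
have l1Z (a : R) x : l1 (a *: x) = a *: l1 x by rewrite /l1 linearZ.
have l2Z (a : R) x : l2 (a *: x) = a *: l2 x by rewrite /l2 linearZ.
have cl1 : continuous l1 by move=> x; apply: (@continuous_comp _ _ _ fst (phi k)); [exact: cvg_fst|exact: phi_continuous].
have cl2 : continuous l2 by move=> x; apply: (@continuous_comp _ _ _ snd (phi k)); [exact: cvg_snd|exact: phi_continuous].
set P := partial_alpha F; set Q := partial_beta F.
have du (l : A * A -> R) : (forall x y, l (x - y) = l x - l y) ->
    (forall a x, l (a *: x) = a *: l x) -> continuous l ->
    (forall p, box (pt z0).1 (pt z0).2 r p ->
      is_derive p (1, 0) (l \o F) (l (P p)) /\ is_derive p (0, 1) (l \o F) (l (Q p))) /\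
    (forall p, box (pt z0).1 (pt z0).2 r p ->
      {for p, continuous (l \o P)} /\ {for p, continuous (l \o Q)}).
  move=> lB lZ cl; split=> p bp; have [d1 d2 c1 c2] := CF _ (bD _ bp).
    by split; exact: is_derive_linear_comp.
  split; first exact: (@continuous_comp _ _ _ P l p c1 (cl _)).
  exact: (@continuous_comp _ _ _ Q l p c2 (cl _)).
have [d1 c1] := du l1 l1B l1Z cl1; have [d2 c2] := du l2 l2B l2Z cl2.
have [M1 hM1] := box_bounded r0 d1 c1.
have [M2 hM2] := box_bounded r0 d2 c2.
exists (M1 + M2), (fun h => cphi k (P (pt (z0 + h)))); split; last first.
  move=> h hr; apply: (le_trans (cmod_le_ReIm _)) => /=.
  by apply: lerD; [exact: hM1 (hbox _ hr)|exact: hM2 (hbox _ hr)].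
(* There are two real components, and each is estimated by [e / 4] times [|Re| + |Im|], itself at
   most twice the modulus. *)
move=> e e0; have e40 : 0 < e / 4 by rewrite divr_gt0.
have [t1 t10 ht1] := box_unif_diff d1 c1 e40.
have [t2 t20 ht2] := box_unif_diff d2 c2 e40.
exists (Num.min t1 t2); first by rewrite lt_min t10.
move=> p q pr qr; rewrite lt_min => /andP[pq1 pq2].
have bp := hbox _ pr; have bq := hbox _ qr.
have pqn : `|pt (z0 + q) - pt (z0 + p)| <= cmod (q - p).
  rewrite normB_pair ge_max /= -!raddfB /= opprD addrACA subrr add0r.
  by rewrite Re_le_cmod Im_le_cmod.
have {ht1} h1 := ht1 _ _ bp bq (le_lt_trans pqn pq1).
have {ht2} h2 := ht2 _ _ bp bq (le_lt_trans pqn pq2).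
(* The Cauchy-Riemann equations turn the real differential into multiplication by the complex number
   [cphi k (P (pt (z0 + p)))]. *)
have QE : Q (pt (z0 + p)) = (- (P (pt (z0 + p))).2, (P (pt (z0 + p))).1).
  by apply: dbar0_partial; exact: dF (bD _ bp).
have xE : (pt (z0 + q)).1 - (pt (z0 + p)).1 = Re (q - p).
  by rewrite /= -raddfB /= opprD addrACA subrr add0r.
have yE : (pt (z0 + q)).2 - (pt (z0 + p)).2 = Im (q - p).
  by rewrite /= -raddfB /= opprD addrACA subrr add0r.
rewrite /= QE xE yE in h1 h2.
have hR := Re_le_cmod (q - p); have hI := Im_le_cmod (q - p).
apply: (le_trans (cmod_le_ReIm _)).
have -> : Re (coord_fun F k (z0 + q) - coord_fun F k (z0 + p) - cphi k (P (pt (z0 + p))) * (q - p)) =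
  l1 (F (pt (z0 + q))) - l1 (F (pt (z0 + p))) -
    (l1 (P (pt (z0 + p))) * Re (q - p) + l1 (- (P (pt (z0 + p))).2, (P (pt (z0 + p))).1) * Im (q - p)).
  by rewrite /coord_fun /cphi /l1; case: (q - p) => x y /=; rewrite raddfN; ring.
have -> : Im (coord_fun F k (z0 + q) - coord_fun F k (z0 + p) - cphi k (P (pt (z0 + p))) * (q - p)) =
  l2 (F (pt (z0 + q))) - l2 (F (pt (z0 + p))) -
    (l2 (P (pt (z0 + p))) * Re (q - p) + l2 (- (P (pt (z0 + p))).2, (P (pt (z0 + p))).1) * Im (q - p)).
  by rewrite /coord_fun /cphi /l2; case: (q - p) => x y /=; ring.
apply: (le_trans (lerD h1 h2)).
have : e / 4 * (`|Re (q - p)| + `|Im (q - p)|) <= e / 4 * (2 * cmod (q - p)).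
  apply: ler_wpM2l; [exact: ltW|lra].
lra.
Qed.

Definition ofpt (z : R * R) : C := (z.1 +i* z.2)%C.

Lemma cmod_ofpt (z : R * R) : cmod (ofpt z) <= 2 * `|z|.
Proof.
apply: (le_trans (cmod_le_ReIm _)); rewrite mulr_natl mulr2n.
have -> : `|z| = Num.max `|z.1| `|z.2| by [].
by rewrite lerD// le_max lexx ?orbT.
Qed.

(* Add the two estimates obtained by exchanging [p] and [q]. *)
Lemma quad_lipschitz (U : C -> Prop) f f' (B : R) p q : quad_on U f f' B ->
  U p -> U q -> cmod (f' q - f' p) <= 2 * B * cmod (q - p).
Proof.
move=> hf Up Uq; have [->|pq] := eqVneq q p; first by rewrite !subrr cmod0 mulr0.
have c0 : 0 < cmod (q - p) by rewrite cmod_gt0 subr_eq0.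
rewrite -(ler_pM2r c0) -cmodM.
have -> : (f' q - f' p) * (q - p) =
  (f q - f p - f' p * (q - p)) + (f p - f q - f' q * (p - q)) by ring.
apply: (le_trans (cmodD _ _)); apply: (le_trans (lerD (hf _ _ Up Uq) (hf _ _ Uq Up))).
rewrite [cmod (p - q)]cmodBC; lra.
Qed.

(** The derivative in a direction [v] of modulus 1 is [g'] times the complex number [ofpt v]. The
    directions 1 and i give derivatives that differ by the factor i, which is [dbar F z0 = 0];
    continuity comes from [quad_lipschitz]. *)
Lemma quad_C1 (F : R * R -> A * A) (z0 : R * R) (d : R) (g g' : 'I_dimA -> C -> C)
    (B : R) : 0 < d -> 0 <= B ->
  (forall k, quad_on (fun z => cmod (z - ofpt z0) < d) (g k) (g' k) B) ->
  (forall z, cmod (ofpt z - ofpt z0) < d ->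
     F z = (\sum_k Re (g k (ofpt z)) *: (basA A)`_k, \sum_k Im (g k (ofpt z)) *: (basA A)`_k)) ->
  [/\ derivable F z0 (1, 0), derivable F z0 (0, 1),
      {for z0, continuous (partial_alpha F)},
      {for z0, continuous (partial_beta F)} & dbar F z0 = 0].
Proof.
move=> d0 B0 qg FE.
pose comb (w : 'I_dimA -> C) : A * A :=
  (\sum_k Re (w k) *: (basA A)`_k, \sum_k Im (w k) *: (basA A)`_k).
pose S := \sum_(k < dimA) `|(basA A)`_k|.
have S0 : 0 <= S by exact: sumr_ge0.
have combB w w' : comb w - comb w' = comb (fun k => w k - w' k).
  by congr (_, _) => /=; rewrite -sumrB; apply: eq_bigr => k _; rewrite raddfB /= scalerBl.
have combZ (a : R) w : a *: comb w = comb (fun k => a%:C%C * w k).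
  by congr (_, _); rewrite scaler_sumr; apply: eq_bigr => k _; rewrite scalerA;
    case: (w k) => x y /=; congr (_ *: _); ring.
have comb_le w (b : R) : (forall k, cmod (w k) <= b) -> `|comb w| <= b * S.
  move=> wb; have -> : `|comb w| = Num.max `|(comb w).1| `|(comb w).2| by [].
  rewrite ge_max.
  apply/andP; split; apply: (le_trans (ler_norm_sum _ _ _)); rewrite mulr_sumr;
    apply: ler_sum => k _; rewrite normrZ ler_wpM2r//; apply: le_trans (wb k).
    exact: Re_le_cmod.
  exact: Im_le_cmod.
have deriv (z : R * R) (v : R * R) : cmod (ofpt z - ofpt z0) < d -> cmod (ofpt v) = 1 ->
    is_derive z v F (comb (fun k => g' k (ofpt z) * ofpt v)).
  move=> zd v1.
  have ofptD (h : R) : ofpt (z + h *: v) = ofpt z + h%:C%C * ofpt v.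
    rewrite /ofpt; apply/eqP; rewrite eq_complex /=.
    by apply/andP; split; apply/eqP; rewrite /GRing.scale /=; ring.
  apply: (@derive_quad _ _ _ _ _ _ _ (B * S) (d - cmod (ofpt z - ofpt z0))); first by rewrite subr_gt0.
  move=> h hd.
  have hz : cmod (ofpt (z + h *: v) - ofpt z0) < d.
    rewrite ofptD addrAC (le_lt_trans (cmodD _ _))// cmodM v1 mulr1 cmod_real.
    by move: hd; lra.
  rewrite (FE _ zd) (FE _ hz) -/(comb (fun k => g k (ofpt z))) -/(comb (fun k => g k (ofpt (z + h *: v)))).
  rewrite combZ combB combB mulrAC; apply: comb_le => k.
  rewrite mulrCA -[h%:C%C * _](addKr (ofpt z)) -ofptD [- _ + _]addrC.
  apply: (le_trans (qg k _ _ zd hz)).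
  by rewrite ofptD [ofpt z + _]addrC addrK cmodM v1 mulr1 cmod_real.
have z0d : cmod (ofpt z0 - ofpt z0) < d by rewrite subrr cmod0.
have c10 : cmod (ofpt (1, 0)) = 1 by rewrite cmodE /= expr0n expr1n addr0 sqrtr1.
have c01 : cmod (ofpt (0, 1)) = 1.
  by rewrite cmodE /= expr0n expr1n add0r sqrtr1.
have cont (v : R * R) : cmod (ofpt v) = 1 -> {for z0, continuous ('D_v F)}.
  move=> v1; apply/cvgrPdist_lt => e e0.
  (* The norm of [R * R] is a maximum, so a modulus is bounded by twice a norm: this turns the
     Lipschitz constant [2 * B] into [4 * B], and [d] into [d / 2]. *)
  have T0 : 0 < 4 * B * S + 1 by rewrite ltr_wpDl// !mulr_ge0.
  have m0 : 0 < Num.min (d / 2) (e / (4 * B * S + 1)) by rewrite lt_min !divr_gt0.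
  near=> z.
  have : `|z0 - z| < Num.min (d / 2) (e / (4 * B * S + 1)).
    by near: z; apply: cvgr_dist_lt => //; exact: cvg_id.
  rewrite lt_min => /andP[z1 z2].
  have zz : cmod (ofpt z - ofpt z0) <= 2 * `|z0 - z|.
    by rewrite distrC; have := cmod_ofpt (z - z0); congr (_ <= _); congr cmod; rewrite /ofpt /=.
  have zd : cmod (ofpt z - ofpt z0) < d by apply: (le_lt_trans zz); rewrite mulrC -ltr_pdivlMr.
  rewrite (@derive_val _ _ _ _ _ _ _ (deriv _ v zd v1)).
  rewrite (@derive_val _ _ _ _ _ _ _ (deriv _ v z0d v1)) combB.
  apply: (@le_lt_trans _ _ ((2 * B * (2 * `|z0 - z|)) * S)).
    apply: comb_le => k; rewrite -mulrBl cmodM v1 mulr1.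
    apply: (le_trans (quad_lipschitz (qg k) zd z0d)); rewrite ler_wpM2l ?mulr_ge0//.
    by rewrite cmodBC.
  apply: (@le_lt_trans _ _ ((4 * B * S + 1) * `|z0 - z|)); last by rewrite mulrC -ltr_pdivlMr.
  have := normr_ge0 (z0 - z); lra.
have D1 := deriv _ (1, 0) z0d c10; have D2 := deriv _ (0, 1) z0d c01.
split; [exact: ex_derive|exact: ex_derive|exact: cont|exact: cont|].
rewrite /dbar /partial_alpha /partial_beta.
rewrite (@derive_val _ _ _ _ _ _ _ D1) (@derive_val _ _ _ _ _ _ _ D2).
rewrite [X in _ *: X](_ : _ = 0) ?scaler0//.
rewrite /comb /tens_i /=; congr (_, _); rewrite /= ?sumrN -?sumrB -?big_split /=;
  apply: big1 => k _; case: (g' k (ofpt z0)) => x y /=.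
  by rewrite -scalerBl (_ : _ - _ = 0) ?scale0r//; ring.
by rewrite -scalerDl (_ : _ + _ = 0) ?scale0r//; ring.
Unshelve. all: by end_near.
Qed.

End HolomorphicStems.

(** * The quadratic cone and complex scalars in the tensor product *)

Section SliceAlgebra.
Variables (R : realType) (A : normedAltStarAlgType R).
Local Notation "x ** y" := (@amul R A x y) (at level 40, left associativity).
Local Notation "1A" := (@aone R A).
Local Notation C := R[i].
Local Notation cmod := (@cmod R).
Local Notation Re := (@complex.Re R).
Local Notation Im := (@complex.Im R).
Local Notation dimA := (dimA A).
Implicit Types (x y s J : A) (z c : C).

Lemma amulx0 x : x ** 0 = 0.
Proof. by rewrite -[X in _ ** X](scale0r 0) amulZr scale0r. Qed.

Definition lmul x (w : A) : A := x ** w.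

Lemma lmul_is_linear x : linear (lmul x).
Proof. by move=> a u v; rewrite /lmul amulDr amulZr. Qed.

HB.instance Definition _ x := GRing.isLinear.Build R A A *:%R (lmul x) (lmul_is_linear x).

Lemma lmul_continuous x : continuous (amul x : A -> A).
Proof. have h := @linear_findim_continuous R A A (lmul x). exact: h. Qed.

(* The element [c s] of the tensor product of A with C. *)
Definition cz c s : A * A := (Re c *: s, Im c *: s).

(** Complex multiples of [1A] associate with every [s], so powers of Delta can be computed in
    [R[i]]. *)
Lemma tens_mul_cz c c' s : tens_mul (cz c 1A) (cz c' s) = cz (c * c') s.
Proof.
rewrite /tens_mul /cz /= !amulZl !amulZr !amul1x !scalerA -scalerBl -scalerDl.
by case: c c' => [a b] [a' b'].
Qed.

Lemma tens_exp_cz c n : tens_exp (cz c 1A) n = cz (c ^+ n) 1A.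
Proof.
elim: n => [|n IH]; first by rewrite /tens_exp /cz /= scale1r scale0r.
by rewrite /tens_exp iterS -/(tens_exp _ _) IH tens_mul_cz exprS.
Qed.

Lemma tens_mulA (w : A * A) s : tens_mul w (tens_of_A s) = (w.1 ** s, w.2 ** s).
Proof. by rewrite /tens_mul /= !amulx0 subr0 add0r. Qed.

Lemma tens_mul_czA c s : tens_mul (cz c 1A) (tens_of_A s) = cz c s.
Proof. by rewrite tens_mulA /cz /= !amulZl !amul1x. Qed.

Lemma tens_of_C_cz z : tens_of_C A (pt z) = cz z 1A.
Proof. by []. Qed.

Section Point.
Variables (al be : R) (J : A).
Hypothesis JS : imag_units A J.
Let y : A := al *: 1A + be *: J.

Let aconj_y : aconj y = al *: 1A - be *: J.
Proof. by rewrite /y aconjD !aconjZ aconj1 imag_unit_conj// scalerN. Qed.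

Lemma trace_pt : trace y = (2 * al) *: 1A.
Proof.
by rewrite /trace aconj_y /y addrACA subrr addr0 -scalerDl mulr_natl mulr2n.
Qed.

Lemma nrm_pt : nrm y = (al ^+ 2 + be ^+ 2) *: 1A.
Proof.
rewrite /nrm aconj_y /y amulDl !amulDr !amulNr !amulZl !amulZr !amul1x amulx1 JS.2.
rewrite !scalerA !scalerN opprK [al * be]mulrC addrA subrK -scalerDl.
by rewrite !expr2.
Qed.

Lemma cone_pt : quadratic_cone A y.
Proof.
have [b0|b0] := eqVneq be 0; first by left; exists al; rewrite /y b0 scale0r addr0.
right; exists (2 * al), (al ^+ 2 + be ^+ 2); split; [exact: trace_pt|exact: nrm_pt|].
have : 0 < be ^+ 2 by rewrite lt_def sqrf_eq0 b0 sqr_ge0.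
by rewrite exprMn; lra.
Qed.

Lemma norm_pt : norm_compatible A -> `|y| = cmod (al +i* be)%C.
Proof.
by move=> An; rewrite (An _ (al ^+ 2 + be ^+ 2)) ?cmodE//; [exact: cone_pt|exact: nrm_pt].
Qed.

End Point.

Lemma imag_units_opp J : imag_units A J -> imag_units A (- J).
Proof.
move=> JS; split; last by rewrite amulNr amulNl opprK JS.2.
by have := cone_pt 0 (-1) JS; rewrite scale0r add0r scaleN1r.
Qed.

(** Completing the square in [x ^ 2 = t x - n], the element [x - t / 2] has square [- d] with
    [d = n - t ^ 2 / 4 > 0], and [J] is its quotient by the square root of [d]. A real [x] takes any
    imaginary unit. *)
Lemma cone_rep (SA : imag_units A !=set0) x : quadratic_cone A x ->
  exists a b J, imag_units A J /\ x = a *: 1A + b *: J.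
Proof.
move=> [[a ->]|[t [n [tx nx tn]]]].
  by have [J JS] := SA; exists a, 0, J; split => //; rewrite scale0r addr0.
have xc : aconj x = t *: 1A - x by rewrite -tx /trace addrC addKr.
have xx : x ** x = t *: x - n *: 1A.
  by rewrite -nx /nrm xc amulDr amulNr amulZr amulx1 opprD opprK addrA subrr add0r.
pose d := n - t ^+ 2 / 4.
have d0 : 0 < d by rewrite /d subr_gt0 ltr_pdivrMr// mulrC.
pose b := Num.sqrt d; have b0 : 0 < b by rewrite sqrtr_gt0.
have b2 : b ^+ 2 = d by rewrite sqr_sqrtr// ltW.
pose J := b^-1 *: (x - (t / 2) *: 1A).
have xE : x = (t / 2) *: 1A + b *: J.
  by rewrite /J scalerA mulfV ?gt_eqF// scale1r addrC subrK.
have Jc : aconj J = - J.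
  have aconjB u v : aconj (u - v) = aconj u - aconj v.
    by rewrite -[- v]scaleN1r aconjD aconjZ scaleN1r.
  rewrite /J aconjZ -[RHS]scalerN opprB aconjB aconjZ aconj1 xc addrAC -scalerBl.
  by congr (_ *: (_ *: _ - _)); field.
have JJ : J ** J = - 1A.
  rewrite /J amulZl amulZr scalerA amulDl !amulDr !amulNr !amulNl opprK.
  rewrite !amulZr !amulZl !amulx1 !amul1x xx scalerA.
  have -> : t *: x - n *: 1A - (t / 2) *: x + (- ((t / 2) *: x) + (t / 2 * (t / 2)) *: 1A) =
    (- d) *: 1A.
    have [h hE] : exists h, h = t / 2 by exists (t / 2).
    rewrite -hE [t *: x - _ - _]addrAC addrACA -!scaleNr -!scalerDl.
    rewrite (_ : t - h - h = 0); last by rewrite hE; field.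
    by rewrite scale0r add0r /d hE; congr (_ *: _); field.
  by rewrite scalerA -[RHS]scaleN1r; congr (_ *: _); rewrite -b2; field; rewrite gt_eqF.
exists (t / 2), b, J; split => //; split => //.
right; exists 0, 1; split.
- by rewrite /trace Jc subrr scale0r.
- by rewrite /nrm Jc amulNr JJ opprK scale1r.
- by rewrite expr0n mulr1 ltr0n.
Qed.

End SliceAlgebra.

(** * Stems of spherical series and their values *)

Section Stems.
Variables (R : realType) (A : normedAltStarAlgType R).
Local Notation "x ** y" := (@amul R A x y) (at level 40, left associativity).
Local Notation "1A" := (@aone R A).
Local Notation C := R[i].
Local Notation cmod := (@cmod R).
Local Notation Re := (@complex.Re R).
Local Notation Im := (@complex.Im R).
Local Notation dimA := (dimA A).
Implicit Types (x y s J : A) (z c : C).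

Definition ev J (w : A * A) : A := w.1 + J ** w.2.

Lemma evD J w w' : ev J (w + w') = ev J w + ev J w'.
Proof. by rewrite /ev /= amulDr addrACA. Qed.

Lemma ev_sum J (F : nat -> A * A) N : ev J (\sum_(n < N) F n) = \sum_(n < N) ev J (F n).
Proof.
elim: N => [|N IH]; first by rewrite !big_ord0 /ev /= amulx0 addr0.
by rewrite !big_ord_recr /= evD IH.
Qed.

Lemma cphiD (k : 'I_dimA) w w' : cphi k (w + w') = cphi k w + cphi k w'.
Proof. by apply/eqP; rewrite eq_complex /= !raddfD /= !eqxx. Qed.

Lemma cphiB (k : 'I_dimA) w w' : cphi k (w - w') = cphi k w - cphi k w'.
Proof. by apply/eqP; rewrite eq_complex /= !raddfB /= !eqxx. Qed.

Lemma cphi_cz (k : 'I_dimA) c s : cphi k (cz c s) = c * (phi k s)%:C%C.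
Proof.
case: c => a b; apply/eqP; rewrite eq_complex /= !linearZ /=.
by apply/andP; split; apply/eqP; rewrite /GRing.scale /=; ring.
Qed.

Lemma cz_conj c s : cz (c^*)%C s = ((cz c s).1, - (cz c s).2).
Proof. by case: c => a b; rewrite /cz /= scaleNr. Qed.

Section Center.
Variables (al be : R) (J : A).
Hypothesis JS : imag_units A J.
Let y : A := al *: 1A + be *: J.

Lemma Delta_stem_pt z : Delta_stem y (pt z) = cz (sph_poly al be z) 1A.
Proof.
rewrite /Delta_stem tens_of_C_cz tens_mul_cz tens_mul_czA trace_pt// nrm_pt//.
case: z => a b; rewrite /cz /sph_poly /qpoly expr2 /=.
by congr (_, _) => /=; rewrite !scalerA -?scalerBl ?addr0 -?scalerDl; congr (_ *: _); ring.
Qed.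

Definition tstem n s (p : R * R) : A * A := tens_mul (spherical_stem y n p) (tens_of_A s).

Lemma tstem_even m s z : tstem (2 * m) s (pt z) = cz (sph_poly al be z ^+ m) s.
Proof.
rewrite /tstem /spherical_stem oddM /= mul2n doubleK Delta_stem_pt tens_exp_cz.
exact: tens_mul_czA.
Qed.

(** The power of Delta is a complex scalar, so the factor [y] passes onto the coefficient [s]
    without associativity. *)
Lemma tstem_odd m s z : tstem (2 * m).+1 s (pt z) =
  cz (sph_poly al be z ^+ m * z) s - cz (sph_poly al be z ^+ m) (y ** s).
Proof.
rewrite /tstem /spherical_stem /= oddM /= mul2n uphalf_double Delta_stem_pt tens_exp_cz.
have -> : tens_mul (cz (sph_poly al be z ^+ m) 1A) (tens_of_C A (pt z) - tens_of_A y) =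
   cz (sph_poly al be z ^+ m * z) 1A - cz (sph_poly al be z ^+ m) y.
  move: (sph_poly al be z ^+ m) => c.
  rewrite -tens_mul_cz tens_of_C_cz /tens_mul /cz /= !subr0.
  congr (_, _); rewrite /= ?amulDr ?amulNr ?amulZl ?amulZr ?amul1x ?amulx1.
    by rewrite addrAC.
  by rewrite addrA.
by rewrite tens_mulA; congr (_, _); rewrite /= amulDl amulNl !amulZl amul1x.
Qed.

Lemma tstem_conj n s z : tstem n s (pt (z^*)%C) =
  ((tstem n s (pt z)).1, - (tstem n s (pt z)).2).
Proof.
have D : sph_poly al be (z^*)%C = ((sph_poly al be z)^*)%C by exact: sph_poly_conj.
have [m [->|->]] : exists m, n = (2 * m)%N \/ n = (2 * m).+1.
  exists n./2; rewrite mul2n; have := odd_double_half n.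
  by case: (odd n) => <-; [right|left]; rewrite ?add1n ?add0n /= ?uphalf_double ?doubleK.
  by rewrite !tstem_even D -rmorphXn /= cz_conj.
rewrite !tstem_odd D -rmorphXn /= -rmorphM /= !cz_conj /=.
by congr (_, _); rewrite /= opprB opprK addrC.
Qed.

Lemma spherical_termE n s a b J' : imag_units A J' ->
  spherical_term y n s (a *: 1A + b *: J') = ev J' (tstem n s (a, b)).
Proof.
move=> J'S; rewrite /spherical_term (@slice_ofE _ _ setT) //.
move=> z _; have := tstem_conj n s (ofpt z); rewrite /tstem.
have -> : pt (ofpt z) = z by case: (z).
have -> : pt ((ofpt z)^*)%C = (z.1, - z.2) by [].
by move=> ->.
Qed.

Definition tsum (s : nat -> A) N z : A * A := \sum_(n < N) tstem n (s n) (pt z).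

Lemma series_tsum (s : nat -> A) N a b J' : imag_units A J' ->
  series (fun n => spherical_term y n (s n) (a *: 1A + b *: J')) N =
  ev J' (tsum s N (a +i* b)%C).
Proof.
move=> J'S; rewrite /series /= big_mkord /tsum (ev_sum J' (fun n => tstem n (s n) (a, b))).
by apply: eq_bigr => n _; rewrite spherical_termE.
Qed.

(** Pairing the terms of ranks [2 j] and [2 j + 1] gives the shape produced by division by Delta,
    with coefficients that are real in each coordinate. *)
Lemma tsum_even (s : nat -> A) m z (k : 'I_dimA) :
  cphi k (tsum s (2 * m) z) = \sum_(j < m) sph_poly al be z ^+ j *
     ((phi k (s (2 * j)%N - y ** s (2 * j).+1))%:C%C + z * (phi k (s (2 * j).+1))%:C%C).
Proof.
elim: m => [|m IH]; first by rewrite muln0 /tsum !big_ord0 /cphi /= !raddf0.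
rewrite big_ord_recr -IH mulnS /tsum !big_ord_recr /= !cphiD -addrA; congr (_ + _).
rewrite -[in X in X + _](add0n (2 * m)%N) tstem_even tstem_odd cphiB !cphi_cz raddfB /= rmorphB /=.
by ring.
Qed.

Lemma DeltaE a b J' : imag_units A J' ->
  Delta y (a *: 1A + b *: J') =
    Re (sph_poly al be (a +i* b)%C) *: 1A + Im (sph_poly al be (a +i* b)%C) *: J'.
Proof.
move=> J'S; rewrite /Delta trace_pt// nrm_pt// amulZr amulx1.
rewrite amulDl !amulDr !amulZl !amulZr amul1x amulx1 J'S.2 amul1x.
rewrite /sph_poly /qpoly expr2 /=; apply: phi_inj => k.
rewrite !(phiD, phiN, phiZ).
by ring.
Qed.

End Center.

(** [Delta y x] lies in the plane of [J'], with coordinates involving neither [J] nor [J'], and on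
    that plane the norm is the modulus. *)
Lemma udistE (An : norm_compatible A) al be J a b J' : imag_units A J -> imag_units A J' ->
  udist (a *: 1A + b *: J') (al *: 1A + be *: J) =
    Num.sqrt (cmod (sph_poly al be (a +i* b)%C)).
Proof.
by move=> JS J'S; rewrite /udist DeltaE// norm_pt//; case: (sph_poly _ _ _).
Qed.

End Stems.

(** * Slice regular functions are spherically analytic *)

Section RegularAnalytic.
Variables (R : realType) (A : normedAltStarAlgType R).
Local Notation "x ** y" := (@amul R A x y) (at level 40, left associativity).
Local Notation "1A" := (@aone R A).
Local Notation C := R[i].
Local Notation cmod := (@cmod R).
Local Notation Re := (@complex.Re R).
Local Notation Im := (@complex.Im R).
Local Notation dimA := (dimA A).
Implicit Types (x y s J : A) (z c : C).

Lemma cvg_sumr (I : Type) (r : seq I) (f : I -> nat -> A) (l : I -> A) :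
  (forall i, f i n @[n --> \oo] --> l i) ->
  \sum_(i <- r) f i n @[n --> \oo] --> \sum_(i <- r) l i.
Proof.
move=> h; elim: r => [|i r IH].
  by rewrite big_nil; under eq_fun do rewrite big_nil; exact: cvg_cst.
by rewrite big_cons; under eq_fun do rewrite big_cons; exact: cvgD.
Qed.

Lemma cvg_phi (u : nat -> A) (l : A) :
  (forall k : 'I_dimA, phi k (u n) @[n --> \oo] --> phi k l) -> u n @[n --> \oo] --> l.
Proof.
move=> h; rewrite [l]phi_sum.
have -> : u = fun n => \sum_(k < dimA) phi k (u n) *: (basA A)`_k.
  by apply/funext => n; exact: phi_sum.
by apply: cvg_sumr => k; apply: cvgZr_tmp; exact: h.
Qed.

Lemma cvg_ev J (u : nat -> A * A) (w : A * A) :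
  (forall k : 'I_dimA, ccvg \oo (fun n => cphi k (u n)) (cphi k w)) ->
  ev J (u n) @[n --> \oo] --> ev J w.
Proof.
move=> h; apply: cvgD.
  by apply: cvg_phi => k; exact: (ccvg_Re (h k)).
apply: (cvg_comp (fun n => (u n).2) (amul J)); last exact: lmul_continuous.
by apply: cvg_phi => k; exact: (ccvg_Im (h k)).
Qed.

(** [(be, J)] and [(- be, - J)] represent the same point; a nonnegative [be] leaves only the cases
    [0 < be] and [be = 0] of the expansion. *)
Lemma imag_rep_nonneg (D : set (R * R)) y : conj_invariant D -> circular A D y ->
  exists al be J, [/\ 0 <= be, imag_units A J, D (al, be) & y = al *: 1A + be *: J].
Proof.
move=> Dc [al [be [J [Dab JS ->]]]]; have [b0|b0] := leP 0 be.
  by exists al, be, J.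
exists al, (- be), (- J); split; [by rewrite oppr_ge0 ltW|exact: imag_units_opp|exact: Dc Dab|].
by rewrite scaleNr scalerN opprK.
Qed.

Lemma uball_rep (An : norm_compatible A) (SA : imag_units A !=set0) al be J (r : R) x :
  imag_units A J -> uball (al *: 1A + be *: J) r x ->
  exists a b J', [/\ imag_units A J', x = a *: 1A + b *: J' &
    cmod (sph_poly al be (a +i* b)%C) < r ^+ 2].
Proof.
move=> JS [/(cone_rep SA)[a [b [J' [J'S ->]]]]]; rewrite udistE// => h.
exists a, b, J'; split => //.
have r0 : 0 < r by apply: le_lt_trans h; exact: sqrtr_ge0.
by rewrite -(sqr_sqrtr (cmod_ge0 _)) ltrXn2r// ?nnegrE ?sqrtr_ge0 ?ltW.
Qed.

Lemma regular_analytic (D : set (R * R)) (f : A -> A) :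
  norm_compatible A -> imag_units A !=set0 -> open D -> conj_invariant D ->
  slice_regular D f -> spherically_analytic (circular A D) f.
Proof.
move=> An SA oD Dc [F [sF CF dF fF]] y Dy.
have [al [be [J [b0 JS Dab yE]]]] := imag_rep_nonneg Dc Dy.
set z0 : C := (al +i* be)%C.
have Dz0 : D (pt z0) by [].
have [rho rho0 [Drho hk]] := holo_unif_diff oD CF dF Dz0.
have Dnear z : cmod (z - z0) < rho -> D (pt z).
  by move=> /ltW/Drho; rewrite addrC subrK.
have csym k : conj_sym (coord_fun F k) z0 rho.
  move=> z /Dnear /sF [/= F1 F2]; apply/eqP; rewrite eq_complex /coord_fun /cphi /=.
  have -> : pt (z^*)%C = (Re z, - Im z) by case: z {F1 F2}.
  by rewrite F1 F2 phiN !eqxx.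
(* Real and nonreal centers are brought to one form, with [L] and [r] chosen before the
   coordinate. *)
have [L [r [r0 L0 Lr H]]] : exists L r : R, [/\ 0 < r, 0 <= L, L * r < 1 &
    forall (g : C -> C) (M : R) (c : nat -> C), conj_sym g z0 rho ->
      (forall j, cmod (c j) <= M * rho^-1 ^+ j) ->
      taylor_bound g z0 c rho M ->
      exists (a b : nat -> R) (K : R), sph_expansion g al be a b K L r].
  have [be0|be0] := eqVneq be 0; last first.
    by apply: sph_expansion_nonreal => //; rewrite lt_def be0.
  by rewrite /z0 be0; exact: sph_expansion_real.
have /choice[t ht] : forall k, exists t : (nat -> R) * (nat -> R) * R,
    sph_expansion (coord_fun F k) al be t.1.1 t.1.2 t.2 L r.
  move=> k; have [M [g' [ud bM]]] := hk k.
  have [c cM ct] := taylor rho0 ud bM.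
  by have [a [b [K hE]]] := H _ _ _ (csym k) cM ct; exists (a, b, K).
(* A single constant dominating those of all coordinates. *)
pose K := \sum_k `|(t k).2|.
have K0 : 0 <= K by exact: sumr_ge0.
have KK k : (t k).2 <= K.
  by rewrite (le_trans (ler_norm _))// /K (bigD1 k)//= lerDl sumr_ge0.
have LX j : 0 <= L ^+ j by exact: exprn_ge0.
have aK k m : `|(t k).1.1 m| <= K * L ^+ m.
  by have [h _ _] := ht k; rewrite (le_trans (h m))// ler_wpM2r.
have bK k m : `|(t k).1.2 m| <= K * L ^+ m.
  by have [_ h _] := ht k; rewrite (le_trans (h m))// ler_wpM2r.
pose bA m : A := \sum_k (t k).1.2 m *: (basA A)`_k.
pose aA m : A := \sum_k (t k).1.1 m *: (basA A)`_k.
pose s n : A := if odd n then bA n./2 else aA n./2 + y ** bA n./2.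
have s_even m : s (2 * m)%N = aA m + y ** bA m by rewrite /s oddM /= mul2n doubleK.
have s_odd m : s (2 * m).+1 = bA m by rewrite /s /= oddM /= mul2n uphalf_double.
(* Left multiplication by [y] mixes the coordinates; [S k] is the sum of the absolute values in the
   k-th row of its matrix. *)
pose S k := \sum_(i < dimA) `|phi k (y ** (basA A)`_i)|.
have S0 k : 0 <= S k by exact: sumr_ge0.
have phi_s k m : `|phi k (s (2 * m)%N)| <= (K + K * S k) * L ^+ m.
  rewrite s_even phiD (le_trans (ler_normD _ _))// mulrDl lerD//.
    by rewrite /aA phi_comb.
  have -> : phi k (y ** bA m) = \sum_(i < dimA) (t i).1.2 m * phi k (y ** (basA A)`_i).
    rewrite -/(lmul y _) linear_sum linear_sum; apply: eq_bigr => i _.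
    by rewrite linearZ; exact: phiZ.
  rewrite (le_trans (ler_norm_sum _ _ _))// mulrAC mulr_sumr; apply: ler_sum => i _.
  by rewrite normrM ler_wpM2r.
(* [r] is for the expansion. Below [rho ^+ 2] a point lies within [rho] of one of the two roots,
   hence in [D]. The ball has radius [Num.sqrt m0] because [udist] is a square root. *)
pose m0 := Num.min r (rho ^+ 2).
have m00 : 0 < m0 by rewrite lt_min r0 exprn_gt0.
have sq : Num.sqrt m0 ^+ 2 = m0 by rewrite sqr_sqrtr// ltW.
exists (Num.sqrt m0), s; split.
- exists y; split; first by rewrite yE; exact: cone_pt.
  by rewrite yE udistE// sph_polyE subrr mul0r cmod0 sqrtr0 sqrtr_gt0.
- move=> x; rewrite yE => /(uball_rep An SA JS)[a [b [J' [J'S ->]]]].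
  rewrite sq lt_min => /andP[_ /(near_root rho0)].
  case=> /Dnear Dz; exists a, b, J'; split => //.
  by have := Dc _ Dz; rewrite /= opprK.
move=> x [ux Dx]; have [a [b [J' [J'S xE]]]] : exists a b J', [/\ imag_units A J', x = a *: 1A + b *: J' &
    cmod (sph_poly al be (a +i* b)%C) < m0].
  by rewrite -sq; apply: (uball_rep An SA JS); rewrite -yE.
rewrite lt_min => /andP[zr zrho].
have Dz : D (a, b).
  case: (near_root rho0 zrho) => /Dnear // Dz.
  by have := Dc _ Dz; rewrite /= opprK.
rewrite fF// xE (slice_ofE sF Dz J'S) -[X in _ --> X]/(ev J' (F (a, b))).
have -> : series (fun n => spherical_term y n (s n) (a *: 1A + b *: J')) =
    fun N => ev J' (tsum al be J s N (a +i* b)%C).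
  by apply/funext => N; rewrite yE series_tsum.
apply: cvg_ev => k.
set z := (a +i* b)%C; set q := L * cmod (sph_poly al be z).
have q01 : 0 <= q < 1.
  rewrite /q mulr_ge0//=; apply: le_lt_trans Lr; rewrite ler_wpM2l// ltW//.
have q0 m : 0 <= q ^+ m by rewrite exprn_ge0//; case/andP: q01.
have even_bound m : cmod (cphi k (tsum al be J s (2 * m) z) - cphi k (F (a, b))) <= K * q ^+ m.
  have [_ _ hE] := ht k; have := hE z zr m.
  rewrite tsum_even// cmodBC => h.
  rewrite (le_trans _ (ler_wpM2r (q0 m) (KK k)))//.
  apply: le_trans h; rewrite le_eqVlt; apply/orP; left; apply/eqP; congr (cmod (_ - _)).
  apply: eq_bigr => j _; rewrite s_even s_odd -yE addrK.
  by rewrite /aA /bA !phi_comb.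
(* The expansion controls only partial sums of even rank; the extra term of an odd rank tends to 0
   by the bound on the coefficients. *)
have odd_bound m : cmod (cphi k (tsum al be J s (2 * m).+1 z) - cphi k (F (a, b))) <=
    (K + (K + K * S k)) * q ^+ m.
  have -> : tsum al be J s (2 * m).+1 z =
      tsum al be J s (2 * m) z + tstem al be J (2 * m) (s (2 * m)%N) (pt z).
    by rewrite /tsum big_ord_recr.
  rewrite cphiD addrAC mulrDl.
  rewrite (le_trans (cmodD _ _))// lerD// tstem_even// cphi_cz cmodM cmodX cmod_real.
  rewrite mulrC (le_trans (ler_wpM2r _ (phi_s k m)))// ?exprn_ge0//.
  by rewrite /q exprMn mulrA.
have bound N : cmod (cphi k (tsum al be J s N z) - cphi k (F (a, b))) <=
    (K + (K + K * S k)) * q ^+ N./2.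
  rewrite -[in tsum _ _ _ _ N](odd_double_half N) -mul2n; case: (odd N); first exact: odd_bound.
  rewrite add0n (le_trans (even_bound _))// ler_wpM2r// lerDl.
  by rewrite addr_ge0// mulr_ge0.
have /cvgrPdist_lt c0 := cvg_geometric0 (K + (K + K * S k)) q01.
move=> e e0; have [N0 _ hN] := c0 _ e0.
exists (2 * N0)%N => // N /= NN; apply: (le_lt_trans (bound N)).
apply: (le_lt_trans (ler_norm _)); rewrite -normrN -sub0r; apply: hN => /=.
by rewrite -(doubleK N0) -mul2n half_leq.
Qed.

End RegularAnalytic.

(** * Spherically analytic functions are slice regular *)

Section AnalyticRegular.
Variables (R : realType) (A : normedAltStarAlgType R).
Local Notation "x ** y" := (@amul R A x y) (at level 40, left associativity).
Local Notation "1A" := (@aone R A).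
Local Notation C := R[i].
Local Notation cmod := (@cmod R).
Local Notation Re := (@complex.Re R).
Local Notation Im := (@complex.Im R).
Local Notation dimA := (dimA A).
Implicit Types (x y J : A) (z c : C).

(* A ball for the pseudo-metric contains the whole sphere of each of its points,
   hence a spherically analytic function is automatically slice, and its stem
   function can be read off from [J] and [- J]. *)
Definition stem_of (J : A) (f : A -> A) (p : R * R) : A * A :=
  let fp := f (p.1 *: 1A + p.2 *: J) in let fm := f (p.1 *: 1A - p.2 *: J) in
  (2^-1 *: (fp + fm), 2^-1 *: (J ** (fm - fp))).

Lemma stem_of_stem J f D : stem_function D (stem_of J f).
Proof.
move=> [a b] _; rewrite /stem_of /= scaleNr opprK; split; first by rewrite addrC.
by rewrite -[RHS]scalerN -amulNr opprB.
Qed.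

Lemma seq_bounded (V : normedModType R) (u : nat -> V) (l : V) :
  u n @[n --> \oo] --> l -> exists2 M : R, 0 <= M & forall n, `|u n| <= M.
Proof.
move=> ul; have cu : cvgn u by apply/cvg_ex; exists l.
have [M [Mr hM]] := cvg_seq_bounded cu.
exists (`|M| + 1); first by rewrite addr_ge0.
by move=> n; apply: hM => //; rewrite (le_lt_trans (ler_norm M))// ltrDl.
Qed.

Section Local.
Variables (f : A -> A) (al be r : R) (J0 : A) (s : nat -> A).
Hypotheses (J0S : imag_units A J0) (r0 : 0 < r).
Let ts := tsum al be J0 s.
Hypothesis fE : forall a b J, imag_units A J -> cmod (sph_poly al be (a +i* b)%C) < r ^+ 2 ->
  ev J (ts N (a +i* b)%C) @[N --> \oo] --> f (a *: 1A + b *: J).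

Let F := stem_of J0 f.

Lemma tsum_cvg a b J : imag_units A J -> cmod (sph_poly al be (a +i* b)%C) < r ^+ 2 ->
  (ts N (a +i* b)%C).1 @[N --> \oo] --> (stem_of J f (a, b)).1 /\
  (ts N (a +i* b)%C).2 @[N --> \oo] --> (stem_of J f (a, b)).2.
Proof.
move=> JS zr; have hp := fE JS zr; have hm := fE (imag_units_opp JS) zr.
rewrite scalerN in hm; rewrite /stem_of /=; split.
  have -> : (fun N => (ts N (a +i* b)%C).1) = (fun N =>
      2^-1 *: (ev J (ts N (a +i* b)%C) + ev (- J) (ts N (a +i* b)%C))).
    apply/funext => N; apply: phi_inj => k.
    by rewrite /ev amulNl !(phiZ, phiD, phiN); field.
  by apply: cvgZl_tmp; exact: cvgD.
have -> : (fun N => (ts N (a +i* b)%C).2) = (fun N =>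
      2^-1 *: (J ** (ev (- J) (ts N (a +i* b)%C) - ev J (ts N (a +i* b)%C)))).
  apply/funext => N; move: (ts N _) => w.
  have -> : ev (- J) w - ev J w = - 2 *: (J ** w.2).
    by apply: phi_inj => k; rewrite /ev amulNl !(phiZ, phiD, phiN); ring.
  (* Left alternativity stands in for associativity: [J ** (J ** w.2)] is [- w.2]. *)
  rewrite amulZr amul_altl JS.2 amulNl amul1x.
  by apply: phi_inj => k; rewrite !(phiZ, phiN); field.
apply: cvgZl_tmp.
exact: (cvg_comp _ (amul J) (cvgB hm hp) (@lmul_continuous R A J _)).
Qed.

(** The components of the partial sums do not involve [J], so their limits, computed with [J0], also
    give the value of [f] on the slice of [J], by uniqueness of limits. *)
Lemma slice_local a b J : imag_units A J -> cmod (sph_poly al be (a +i* b)%C) < r ^+ 2 ->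
  f (a *: 1A + b *: J) = ev J (F (a, b)).
Proof.
move=> JS zr; have [h1 h2] := tsum_cvg J0S zr.
apply: (norm_cvg_unique (fE JS zr)).
apply: cvgD => //.
by apply: (cvg_comp (fun N => (ts N (a +i* b)%C).2) (amul J) h2); exact: lmul_continuous.
Qed.

(* The series converges at [z = al + i tau], where Delta takes the real value
   [- del]; the imaginary part of an odd term then isolates its coefficient. *)
Lemma coef_bound : exists (K L : R), 0 <= L /\ forall (k : 'I_dimA) m,
  `|phi k (s (2 * m)%N - (al *: 1A + be *: J0) ** s (2 * m).+1)| <= K * L ^+ m /\
  `|phi k (s (2 * m).+1)| <= K * L ^+ m.
Proof.
pose del := r ^+ 2 / 2.
have r20 : 0 < r ^+ 2 by rewrite exprn_gt0.
have del0 : 0 < del by rewrite divr_gt0.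
pose tau := Num.sqrt (be ^+ 2 + del).
have tau0 : 0 < tau by rewrite sqrtr_gt0 ltr_wpDl// sqr_ge0.
have tau2 : tau ^+ 2 = be ^+ 2 + del by rewrite sqr_sqrtr// addr_ge0 ?sqr_ge0 ?ltW.
pose z : C := (al +i* tau)%C.
have DE : sph_poly al be z = (- del)%:C%C.
  apply/eqP; rewrite eq_complex /sph_poly /qpoly expr2 /=.
  by apply/andP; split; apply/eqP; move: tau2; rewrite !expr2; lra.
have cD : cmod (sph_poly al be z) = del by rewrite DE cmod_real normrN gtr0_norm.
have zr : cmod (sph_poly al be z) < r ^+ 2 by rewrite cD /del; lra.
have [/seq_bounded[M1 M10 hM1] /seq_bounded[M2 M20 hM2]] := tsum_cvg J0S zr.
have [P P0 hP] := phi_bounded A.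
pose M := P * M1 + P * M2.
have M0 : 0 <= M by rewrite addr_ge0// mulr_ge0// ltW.
have hM (k : 'I_dimA) N : cmod (cphi k (ts N z)) <= M.
  apply: (le_trans (cmod_le_ReIm _)); rewrite lerD//=.
    by rewrite (le_trans (hP _ _))// ler_wpM2l// ltW.
  by rewrite (le_trans (hP _ _))// ler_wpM2l// ltW.
have hi (k : 'I_dimA) N : cmod (cphi k (tstem al be J0 N (s N) (pt z))) <= 2 * M.
  have -> : tstem al be J0 N (s N) (pt z) = ts N.+1 z - ts N z.
    by rewrite /ts /tsum big_ord_recr /= [RHS]addrAC subrr add0r.
  by rewrite cphiB (le_trans (cmodB _ _))// mulr_natl mulr2n lerD.
have dm m : 0 < del ^+ m by exact: exprn_gt0.
have even_le (k : 'I_dimA) m : `|phi k (s (2 * m)%N)| <= 2 * M * del^-1 ^+ m.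
  have := hi k (2 * m)%N; rewrite tstem_even// cphi_cz cmodM cmodX cD cmod_real.
  by rewrite exprVn mulrC -ler_pdivlMr.
have odd_le (k : 'I_dimA) m : `|phi k (s (2 * m).+1)| <= 2 * M / tau * del^-1 ^+ m.
  have := hi k (2 * m).+1; rewrite tstem_odd// cphiB !cphi_cz -mulrA -mulrBr cmodM cmodX cD.
  move=> h.
  have -> : 2 * M / tau * del^-1 ^+ m = 2 * M / (del ^+ m * tau).
    by rewrite exprVn invfM; ring.
  rewrite ler_pdivlMr ?mulr_gt0//; apply: le_trans h.
  rewrite mulrCA; apply: ler_wpM2l; first exact: ltW.
  apply: le_trans (Im_le_cmod _).
  by rewrite /z /= mulr0 add0r subr0 normrM (gtr0_norm tau0) mulrC.
pose y : A := al *: 1A + be *: J0.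
(* The sum over [k] makes the constant independent of the coordinate. *)
pose S := \sum_(k < dimA) \sum_(i < dimA) `|phi k (y ** (basA A)`_i)|.
have L0 : 0 <= del^-1 by rewrite invr_ge0 ltW.
have LX m : 0 <= del^-1 ^+ m by exact: exprn_ge0.
have S0 : 0 <= S by apply: sumr_ge0 => k _; exact: sumr_ge0.
have Mt : 0 <= 2 * M / tau by rewrite divr_ge0 ?mulr_ge0// ltW.
have ys_le (k : 'I_dimA) m : `|phi k (y ** s (2 * m).+1)| <= 2 * M / tau * S * del^-1 ^+ m.
  have -> : phi k (y ** s (2 * m).+1) =
      \sum_(i < dimA) phi i (s (2 * m).+1) * phi k (y ** (basA A)`_i).
    rewrite {1}[s _]phi_sum -/(lmul y _) linear_sum linear_sum; apply: eq_bigr => i _.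
    by rewrite linearZ; exact: phiZ.
  rewrite (le_trans (ler_norm_sum _ _ _))//.
  apply: (@le_trans _ _ (2 * M / tau * (\sum_(i < dimA) `|phi k (y ** (basA A)`_i)|) * del^-1 ^+ m)).
    rewrite mulrAC mulr_sumr; apply: ler_sum => i _.
    by rewrite normrM ler_wpM2r.
  have -> : S = \sum_(i < dimA) `|phi k (y ** (basA A)`_i)| +
      \sum_(j < dimA | j != k) \sum_(i < dimA) `|phi j (y ** (basA A)`_i)|.
    by rewrite /S (bigD1 k).
  rewrite ler_wpM2r// ler_wpM2l// lerDl sumr_ge0// => j _.
  exact: sumr_ge0.
have MS : 0 <= 2 * M / tau * S by rewrite mulr_ge0.
exists (2 * M + 2 * M / tau * S + 2 * M / tau), del^-1; split => // k m; split.
  rewrite phiD phiN (le_trans (ler_normB _ _))// (le_trans (lerD (even_le k m) (ys_le k m)))//.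
  by rewrite -mulrDl ler_wpM2r// lerDl.
by rewrite (le_trans (odd_le k m))// ler_wpM2r// lerDr addr_ge0// mulr_ge0.
Qed.

(** Near the center each coordinate of [F] coincides with a [qser], both being limits of the partial
    sums of even rank; [qser_quad] and [quad_C1] then apply. *)
Lemma holo_local :
  [/\ derivable F (al, be) (1, 0), derivable F (al, be) (0, 1),
      {for (al, be), continuous (partial_alpha F)},
      {for (al, be), continuous (partial_beta F)} & dbar F (al, be) = 0].
Proof.
have [K [L [L0 hKL]]] := coef_bound.
pose z0 : C := (al +i* be)%C.
pose a (k : 'I_dimA) m : C := (phi k (s (2 * m)%N - (al *: 1A + be *: J0) ** s (2 * m).+1))%:C%C.
pose b (k : 'I_dimA) m : C := (phi k (s (2 * m).+1))%:C%C.
have aK k m : cmod (a k m) <= K * L ^+ m by rewrite cmod_real; have [] := hKL k m.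
have bK k m : cmod (b k m) <= K * L ^+ m by rewrite cmod_real; have [] := hKL k m.
pose T : C := (2 * al)%:C%C; pose M : C := (al ^+ 2 + be ^+ 2)%:C%C.
have D0 : qpoly T M z0 = 0 by rewrite -[qpoly T M z0]/(sph_poly al be z0) sph_polyE subrr mul0r.
have Lz0 : L * cmod (qpoly T M z0) < 1 by rewrite D0 cmod0 mulr0.
have [d [B [d0 B0 hq]]] := qser_quad K L0 Lz0.
have /choice[g' hg'] : forall k, exists g', quad_on (fun p => cmod (p - z0) < d) (qser (a k) (b k) T M) g' B.
  by move=> k; exact: hq.
(* Below [r ^+ 2] the spherical series converges to [f]; below [(L + 1)^-1] the power series in
   Delta converge, even if [L = 0]. *)
pose m0 := Num.min (r ^+ 2) (L + 1)^-1.
have L10 : 0 < L + 1 by rewrite ltr_wpDl.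
have m00 : 0 < m0 by rewrite lt_min exprn_gt0//= invr_gt0.
have G0 : 0 < 1 + 2 * `|be| by rewrite ltr_wpDr// mulr_ge0.
(* Within distance 1 of [z0], the other root is at distance at most [1 + 2 * |be|], which bounds the
   second factor of Delta. *)
pose d' := Num.min d (Num.min 1 (m0 / (1 + 2 * `|be|))).
have d'0 : 0 < d' by rewrite !lt_min d0 ltr01 divr_gt0.
have small z : cmod (z - z0) < d' -> cmod (sph_poly al be z) < m0.
  rewrite lt_min => /andP[_]; rewrite lt_min => /andP[h1 h2].
  rewrite sph_polyE cmodM; apply: (@le_lt_trans _ _ (cmod (z - z0) * (1 + 2 * `|be|))).
    rewrite ler_wpM2l// (le_trans (cmod_dist3 _ z0 _))// lerD ?(ltW h1)//.
    have -> : z0 - (al -i* be)%C = (0 +i* (2 * be))%C.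
      by apply/eqP; rewrite eq_complex /=; apply/andP; split; apply/eqP; ring.
    by rewrite cmodE /= expr0n add0r sqrtr_sqr normrM normr_nat.
  by rewrite -ltr_pdivlMr.
apply: (@quad_C1 _ _ F (al, be) d' (fun k => qser (a k) (b k) T M) g' B) => //.
  move=> k p q hp hp'; apply: hg'.
    by apply: (lt_le_trans hp); rewrite ge_min lexx.
  by apply: (lt_le_trans hp'); rewrite ge_min lexx.
move=> p /small; set z := ofpt p; rewrite lt_min => /andP[zr zL].
have Lz : L * cmod (qpoly T M z) < 1.
  rewrite -[qpoly T M z]/(sph_poly al be z).
  apply: (@le_lt_trans _ _ (L * (L + 1)^-1)); first by rewrite ler_wpM2l// ltW.
  by rewrite ltr_pdivrMr// mul1r ltrDl.
have pE : p = (p.1, p.2) by case: (p).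
have [c1 c2] := tsum_cvg J0S zr.
rewrite -/F -pE in c1 c2.
have key k : cphi k (F p) = qser (a k) (b k) T M z.
  have h1 : ccvg \oo (fun N => cphi k (ts N z)) (cphi k (F p)).
    apply: ccvg_ReIm => /=.
      by apply: (cvg_comp (fun N => (ts N z).1) (phi k) c1); exact: phi_continuous.
    by apply: (cvg_comp (fun N => (ts N z).2) (phi k) c2); exact: phi_continuous.
  have h2 : ccvg \oo (fun m => cphi k (ts (2 * m) z)) (cphi k (F p)).
    move=> e e0; have [N _ hN] := h1 _ e0; exists N => // m /= Nm; apply: hN => /=.
    by rewrite (leq_trans Nm)// leq_pmull.
  have h3 := ccvgD (pser_cvg L0 (aK k) Lz) (ccvgMr z (pser_cvg L0 (bK k) Lz)).
  apply: (ccvg_uniq h2); rewrite /qser [z * _]mulrC.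
  move=> e e0; have [N _ hN] := h3 _ _ _ e0; exists N => // m /= /hN /=.
  rewrite /ts tsum_even//; congr (cmod (_ - _) < e).
  rewrite /psum mulr_suml -big_split /=; apply: eq_bigr => j _.
  by rewrite /a /b -[qpoly T M z]/(sph_poly al be z); ring.
rewrite [LHS]surjective_pairing; congr (_, _).
  by rewrite [LHS]phi_sum; apply: eq_bigr => k _; rewrite -key.
by rewrite [LHS]phi_sum; apply: eq_bigr => k _; rewrite -key.
Qed.

End Local.

(** The unit [J0] is the same at all centers, so every local expansion describes the one global stem
    [stem_of J0 f], which is differentiated only at the center of the expansion. *)
Lemma analytic_regular (D : set (R * R)) (f : A -> A) :
  norm_compatible A -> imag_units A !=set0 -> conj_invariant D ->
  spherically_analytic (circular A D) f -> slice_regular D f.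
Proof.
move=> An [J0 J0S] Dc fan; exists (stem_of J0 f).
have stF := @stem_of_stem J0 f D.
have local (z : R * R) : D z -> exists (r : R) (s : nat -> A), 0 < r /\ forall a b J, imag_units A J ->
    cmod (sph_poly z.1 z.2 (a +i* b)%C) < r ^+ 2 ->
    ev J (tsum z.1 z.2 J0 s N (a +i* b)%C) @[N --> \oo] --> f (a *: 1A + b *: J).
  case: z => al be Dz /=.
  have Vy : circular A D (al *: 1A + be *: J0) by exists al, be, J0.
  have [r [s [[x [_ xr]] UV hs]]] := fan _ Vy.
  (* The ball is non-empty, which forces a positive radius. *)
  have r0 : 0 < r by apply: le_lt_trans xr; exact: sqrtr_ge0.
  exists r, s; split => // a b J JS zr.
  have Ux : uball (al *: 1A + be *: J0) r (a *: 1A + b *: J).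
    split; first exact: cone_pt.
    by rewrite udistE// -(ger0_norm (ltW r0)) -sqrtr_sqr ltr_sqrt// exprn_gt0.
  have := hs _ (conj Ux (UV _ Ux)).
  have -> : series (fun n => spherical_term (al *: 1A + be *: J0) n (s n) (a *: 1A + b *: J)) =
    fun N => ev J (tsum al be J0 s N (a +i* b)%C) by apply/funext => N; rewrite series_tsum.
  by [].
have center (z : R * R) (r : R) : 0 < r -> cmod (sph_poly z.1 z.2 (z.1 +i* z.2)%C) < r ^+ 2.
  by move=> r0; rewrite sph_polyE subrr mul0r cmod0 exprn_gt0.
split => //.
- case=> al be /local[r [s [r0 h]]].
  by have [h1 h2 h3 h4 _] := @holo_local f al be r J0 s J0S r0 h; split.
- case=> al be /local[r [s [r0 h]]].
  by have [_ _ _ _ h5] := @holo_local f al be r J0 s J0S r0 h.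
move=> x [a [b [J [Dab JS ->]]]]; rewrite (slice_ofE stF Dab JS).
have [r [s [r0 h]]] := local _ Dab.
exact: (slice_local J0S h JS (center (a, b) r r0)).
Qed.

End AnalyticRegular.
Theorem theorem1p8 (R : realType) (A : normedAltStarAlgType R)
    (A_norm : norm_compatible A)
    (SA_nonempty : imag_units A !=set0)
    (D : set (R * R)) (D_nonempty : D !=set0) (D_open : open D)
    (D_conj : conj_invariant D) (OmegaD_connected : connected (circular A D))
    (f : A -> A) :
  (D `&` [set z | z.2 = 0] = set0 ->
     (slice_regular D f <->
      slice_function D f /\ spherically_analytic (circular A D) f)) /\
  (D `&` [set z | z.2 = 0] !=set0 ->
     (slice_regular D f <-> spherically_analytic (circular A D) f)).
Proof.
(* Both assertions come from this equivalence; the stem that witnesses slice regularity also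
   witnesses that [f] is a slice function. *)
have reg : slice_regular D f <-> spherically_analytic (circular A D) f.
  by split; [exact: regular_analytic|exact: analytic_regular].
split=> _ //; split=> [fr|[_ /reg]//]; split; last exact/reg.
by have [F [sF _ _ fF]] := fr; exists F.
Qed.
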